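(* Consider the two-lane simple exclusion process described in the context. Then there is a one-parameter family $\{\nu_\rho:0\le\rho\le 2\}$ of probability measures on $\mathcal X$ such that $$(\mathcal I\cap\mathcal S)_e=\{\nu^{\rho_0,\rho_1}:(\rho_0,\rho_1)\in\mathcal F\}=\{\nu_\rho:\rho\in[0,2]\},$$ where the parameter $\rho$ is the total mean density over the two lanes, i.e. $\mathbb E_{\nu_\rho}\{\eta(0,0)+\eta(0,1)\}=\rho$ for every $\rho\in[0,2]$.
   Context: Let $W=\{0,1\}$, $V=\mathbb Z\times W$ and $\mathcal X=\{0,1\}^V$ with the product topology. For $x\in V$ write $x=(x(0),x(1))$ with $x(0)\in\mathbb Z$ and $x(1)\in W$ (the lane). Parameters: $p,q,d_0,l_0,d_1,l_1\ge 0$ with $(d_0+l_0)(d_1+l_1)>0$; $\gamma_i:=d_i-l_i$ is the drift on lane $i$. Standing assumption: $\gamma_0\ge 0$, $\gamma_0+\gamma_1\ge 0$, $p\ge q$, $p>0$. Kernel: for $z\in\mathbb Z$ and $i\in W$, $p((z,i),(z+1,i))=d_i$, $p((z,i),(z-1,i))=l_i$, $p((z,0),(z,1))=p$, $p((z,1),(z,0))=q$, and $p(x,y)=0$ otherwise. The two-lane simple exclusion process (SEP) is the Markov process on $\mathcal X$ whose generator acts on cylinder functions $f$ (functions depending on finitely many sites) by $$Lf(\eta)=\sum_{x,y\in V}p(x,y)\,\eta(x)(1-\eta(y))\,\big(f(\eta^{x,y})-f(\eta)\big),$$ where $\eta^{x,y}$ is obtained from $\eta$ by moving a particle from $x$ to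 $y$. $\mathcal I$ is the set of invariant probability measures of this process; $\mathcal S$ is the set of probability measures on $\mathcal X$ invariant under all horizontal translations $(\tau_k\eta)(z,w)=\eta(z+k,w)$, $k\in\mathbb Z$. For a convex set $A$ of probability measures, $A_e$ denotes its set of extremal elements. For $(\rho_0,\rho_1)\in[0,1]^2$, $\nu^{\rho_0,\rho_1}$ is the product probability measure on $\mathcal X$ under which $\eta(z,i)$ is Bernoulli with parameter $\rho_i$ for all $z\in\mathbb Z$, $i\in W$. Finally, $$\mathcal F:=\{(\rho_0,\rho_1)\in[0,1]^2:\ p\rho_0(1-\rho_1)-q\rho_1(1-\rho_0)=0\}.$$ *)

(* Defs.v *)
From HB Require Import structures.
From mathcomp Require Import all_boot all_order all_algebra.
From mathcomp Require Import all_classical all_reals all_analysis.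
From mathcomp Require Import giry.

Set Implicit Arguments.
Unset Strict Implicit.
Unset Printing Implicit Defensive.

Import Order.TTheory GRing.Theory Num.Theory.
Import numFieldNormedType.Exports.

Local Open Scope classical_set_scope.
Local Open Scope ring_scope.

(* A site is (position, lane); [false] is lane 0 and [true] is lane 1. *)
Notation site := (int * bool)%type.

Definition config : Type := prod_topology (fun _ : site => bool).
HB.instance Definition _ := Pointed.on config.
HB.instance Definition _ := Nbhs.on config.
HB.instance Definition _ := Topological.on config.
HB.instance Definition _ := Uniform.on config.

Definition borel_config := g_sigma_algebraType (@open config).

Section two_lane.
Context {R : realType}.

Definition jump_rate (p q d0 l0 d1 l1 : R) (x y : site) : R :=
  if x.2 == y.2 then
    if y.1 == x.1 + 1 then (if x.2 then d1 else d0)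
    else if y.1 == x.1 - 1 then (if x.2 then l1 else l0)
    else 0
  else if y.1 == x.1 then (if x.2 then q else p)
  else 0.

(* Only meaningful when x is occupied and y is empty, the only case that
   contributes to the generator. *)
Definition move_particle (eta : config) (x y : site) : config :=
  fun z => if z == y then true else if z == x then false else eta z.

Definition cylinder_function (f : config -> R) : Prop :=
  exists A : seq site, forall eta zeta : config,
    {in A, eta =1 zeta} -> f eta = f zeta.

(* The sum is a finitely supported one: if f depends only on the sites of a
   finite set A, a nonzero term needs p(x,y) <> 0 and one of x, y in A. *)
Definition pregenerator (p q d0 l0 d1 l1 : R) (f : config -> R)
    (eta : config) : R :=
  \sum_(e \in [set: site * site])
    jump_rate p q d0 l0 d1 l1 e.1 e.2 * (eta e.1)%:R * (1 - (eta e.2)%:R) *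
    (f (move_particle eta e.1 e.2) - f eta).

(* S t f is only specified for t >= 0 and f continuous. *)
Record markov_semigroup (S : R -> (config -> R) -> config -> R) : Prop := {
  semigroup_continuous : forall (t : R) (f : config -> R), 0 <= t -> continuous f ->
    continuous (S t f);
  semigroup_linear : forall (t a : R) (f g : config -> R), 0 <= t -> continuous f -> continuous g ->
    S t (fun eta => a * f eta + g eta) =
    (fun eta => a * S t f eta + S t g eta);
  semigroup0 : forall f : config -> R, continuous f -> S 0 f = f;
  semigroup_right_continuous : forall (t : R) (f : config -> R), 0 <= t -> continuous f ->
    {uniform, (S ^~ f) @ t^'+ --> S t f};
  semigroupD : forall (s t : R) (f : config -> R), 0 <= s -> 0 <= t -> continuous f ->
    S (s + t) f = S s (S t f);
  semigroup1 : forall t : R, 0 <= t -> S t (cst 1) = cst 1;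
  semigroup_ge0 : forall (t : R) (f : config -> R), 0 <= t -> continuous f ->
    (forall eta, 0 <= f eta) -> forall eta, 0 <= S t f eta }.

Definition markov_generator (S : R -> (config -> R) -> config -> R)
    (f g : config -> R) : Prop :=
  [/\ continuous f, continuous g &
    {uniform, (fun t : R => fun eta : config => t^-1 * (S t f eta - f eta))
              @ 0^'+ --> g}].

(* (f, g) is in the closure, in C(X) x C(X), of the graph of the
   pregenerator on cylinder functions. *)
Definition pregenerator_closure (p q d0 l0 d1 l1 : R)
    (f g : config -> R) : Prop :=
  exists h : nat -> config -> R,
    [/\ forall n, cylinder_function (h n), {uniform, h @ \oo --> f} &
      {uniform, (fun n => pregenerator p q d0 l0 d1 l1 (h n)) @ \oo --> g}].

(* The process is given by its semigroup on C(X); as usual for interacting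
   particle systems, its generator is the closure of L on cylinder functions,
   which determines S t f for all t >= 0 and f continuous. *)
Definition sep_semigroup (p q d0 l0 d1 l1 : R)
    (S : R -> (config -> R) -> config -> R) : Prop :=
  markov_semigroup S /\
  forall f g, markov_generator S f g <-> pregenerator_closure p q d0 l0 d1 l1 f g.

Definition invariant_measures (S : R -> (config -> R) -> config -> R) :
    set (probability borel_config R) :=
  [set mu : probability borel_config R | forall (t : R) (f : config -> R), 0 <= t -> continuous f ->
    ('E_mu[S t f] = 'E_mu[f])%E].

Definition translate (k : int) (eta : config) : config :=
  fun x => eta (x.1 + k, x.2).

Definition translation_invariant : set (probability borel_config R) :=
  [set mu : probability borel_config R | forall (k : int) (B : set borel_config), measurable B ->
    mu (translate k @^-1` B) = mu B].

(* Measures are compared with [measure_eq], i.e. on measurable sets: a library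
   measure is a function on all sets, unconstrained on non-measurable ones, so
   Leibniz equality would be too fine. *)
Definition extremal (A : set (probability borel_config R)) :
    set (probability borel_config R) :=
  [set mu : probability borel_config R | A mu /\
    forall (mu1 mu2 : probability borel_config R) (a : R),
      A mu1 -> A mu2 -> 0 < a < 1 ->
      (forall B : set borel_config, measurable B ->
        mu B = a%:E * mu1 B + (1 - a)%:E * mu2 B)%E ->
      measure_eq mu1 mu /\ measure_eq mu2 mu].

(* mu is the product measure whose marginal at (z, i) is Bernoulli with
   parameter r_i. *)
Definition product_bernoulli (r0 r1 : R) (mu : probability borel_config R) :
    Prop :=
  forall (A : seq site) (a : config), uniq A ->
    mu [set eta : config | {in A, eta =1 a}] =
    (\prod_(x <- A) bernoulli_pmf (if x.2 then r1 else r0) (a x))%:E.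

Definition calF (p q : R) : set (R * R) :=
  [set r | [/\ 0 <= r.1 <= 1, 0 <= r.2 <= 1 &
    p * r.1 * (1 - r.2) - q * r.2 * (1 - r.1) = 0]].

End two_lane.

(* Main.v *)
(* A translation-invariant stationary measure is treated by relative entropy.
   Let h be the density of its restriction to a box with respect to the weight
   a ^ (particles in lane 1), p = q a, which makes the vertical jumps reversible
   and is preserved by horizontal jumps up to boundary terms.  Testing
   stationarity on the cylinder function log h, every bond inside the box
   contributes minus a relative-entropy term, while the bonds at the two ends
   contribute a bounded amount.  By translation invariance a bond across which h
   is not symmetric would contribute a multiple of the length of the box, so no
   such bond exists.  Hence the translation-invariant stationary measures are
   exactly the measures that are exchangeable within each lane and balanced,
   p mu(u = 1, v = 0, ..) = q mu(u = 0, v = 1, ..) for u in lane 0 and v in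
   lane 1.  When q = 0 no weight a exists, but then the mean occupation of a
   lane-0 site shows that vertical jumps never occur, and they can be dropped.

   If such a measure is extremal, conditioning on the state of one site and
   relabelling the other sites of its lane gives again such a measure, which by
   extremality is the original one: the sites are independent.  Conversely, a
   product measure is extremal by the law of large numbers along translates. *)

Require Import Defs.
From mathcomp Require Import all_boot all_order all_algebra.
From mathcomp Require Import all_classical all_reals all_analysis.
From mathcomp Require Import giry measurable_realfun.
From mathcomp Require Import ring lra zify.
Import Order.TTheory GRing.Theory Num.Theory.
Import numFieldNormedType.Exports.
Local Open Scope classical_set_scope.
Local Open Scope ring_scope.
Set Implicit Arguments.
Unset Strict Implicit.
Unset Printing Implicit Defensive.

(** * Cylinder sets *)

(** The logarithm is the first obstacle: a stationary measure may give mass 0 to some pattern. The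
    entropy argument is therefore run for its half-and-half mixture with a fully supported Bernoulli
    product measure that is stationary itself. The identities obtained are linear in the measure and
    hold for the product measure, so they pass back to the original one. The second obstacle is that
    jumps along a lane may go one way only, so nothing is reversible there. The estimate for one
    directed bond is [- kl] plus a difference of two mean jump indicators. Within a lane this
    difference vanishes by translation invariance; between lanes it cancels between the two
    directions because [p = q * a]. A horizontal bond is thus controlled as soon as one of its
    directions has positive rate. Stationarity enters only as [ev mu (pregenerator .. f) = 0] for
    cylinder [f]. This is equivalent to invariance because the generator is the closure of its
    restriction to cylinder functions and commutes with the semigroup. *)

Definition cyl (A : seq site) (c : config) : set config :=
  [set eta : config | {in A, eta =1 c}].

Lemma nbhs_cyl (eta : config) (U : set config) :
  nbhs eta U -> exists A, cyl A eta `<=` U.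
Proof.
(* The sets that contain a cylinder around [eta] form a filter. The product topology is a supremum
   over coordinates, so convergence of this filter to [eta] is checked one site at a time. *)
pose F : set_system config := [set U | exists A, cyl A eta `<=` U].
have FF : Filter F.
  constructor; first by exists [::].
    move=> P Q [A AP] [B BQ]; exists (A ++ B) => z zAB; split.
      by apply: AP => x xA; apply: zAB; rewrite mem_cat xA.
    by apply: BQ => x xB; apply: zAB; rewrite mem_cat xB orbT.
  by move=> P Q PQ [A AP]; exists A; exact: subset_trans PQ.
suff : F --> eta by apply.
apply/cvg_sup => x V [W] [[W'] oW' <-] Weta WV.
apply: (filterS WV); exists [:: x] => z zx /=.
by rewrite zx ?inE.
Qed.

Lemma cyl_nil c : cyl [::] c = setT.
Proof. by apply/seteqP; split. Qed.

Lemma cyl_open A c : open (cyl A c).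
Proof.
elim: A => [|x A IH]; first by rewrite cyl_nil; exact: openT.
rewrite (_ : cyl _ _ = ((fun eta : config => eta x) @^-1` [set c x]) `&` cyl A c).
  apply: openI => //; apply: open_comp; last exact: discrete_open.
  by move=> eta _; apply: (@proj_continuous site (fun=> bool) x).
apply/seteqP; split => eta /=.
  move=> H; split; first by apply: H; rewrite mem_head.
  by move=> y yA; apply: H; rewrite inE yA orbT.
by move=> [H1 H2] y /predU1P[->//|/H2].
Qed.

Lemma config_compact : compact [set: config].
Proof.
have := @tychonoff site (fun=> bool) (fun=> setT) (fun=> bool_compact).
by congr compact; apply/seteqP; split.
Qed.

Lemma cyl_cat A B c : cyl (A ++ B) c = cyl A c `&` cyl B c.
Proof.
apply/seteqP; split => eta /=.
  by move=> H; split=> x xA; apply: H; rewrite mem_cat xA ?orbT.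
by move=> [H1 H2] x; rewrite mem_cat => /orP[/H1|/H2].
Qed.

Lemma cyl_cons x A c : cyl (x :: A) c = cyl [:: x] c `&` cyl A c.
Proof. exact: (cyl_cat [:: x]). Qed.

Lemma cyl1 x c : cyl [:: x] c = [set eta : config | eta x = c x].
Proof.
apply/seteqP; split=> eta /=; first by apply; rewrite inE.
by move=> H y; rewrite inE => /eqP ->.
Qed.

Lemma eq_cyl A c c' : {in A, c =1 c'} -> cyl A c = cyl A c'.
Proof.
by move=> H; apply/seteqP; split => eta /= E x xA; rewrite E// H.
Qed.

Lemma eq_mem_cyl A B c : A =i B -> cyl A c = cyl B c.
Proof. by move=> AB; apply/seteqP; split=> eta /= H x; [rewrite -AB|rewrite AB] => /H. Qed.

Lemma measurable_cyl A c : measurable (cyl A c : set borel_config).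
Proof. by apply: sub_sigma_algebra; exact: cyl_open. Qed.

Lemma measurable_site x b : measurable ([set eta : config | eta x = b] : set borel_config).
Proof. by have := measurable_cyl [:: x] (fun=> b); rewrite cyl1. Qed.

(* A finite list of (site, value) constraints, consistent or not. *)
Definition scyl (s : seq (site * bool)) : set config :=
  [set eta : config | forall e, e \in s -> eta e.1 = e.2].

Lemma scylP s : scyl s = set0 \/ exists2 A, uniq A & exists c, scyl s = cyl A c.
Proof.
have [[eta etas]|H] := pselect (scyl s !=set0); last first.
  by left; apply/seteqP; split=> // eta es; exfalso; apply: H; exists eta.
right; exists (undup [seq e.1 | e <- s]); first exact: undup_uniq.
exists eta; apply/seteqP; split=> z /= zs.
  move=> x; rewrite mem_undup => /mapP[e es ->].
  by rewrite zs// etas.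
move=> e es; rewrite zs ?etas// mem_undup; apply/mapP; by exists e.
Qed.

Lemma cyl_scyl A c : cyl A c = scyl [seq (x, c x) | x <- A].
Proof.
apply/seteqP; split=> z /= zA.
  by move=> e /mapP[x xA ->]; exact: zA.
by move=> x xA; apply: (zA (x, c x)); apply/mapP; exists x.
Qed.

Lemma open_bigcup_scyl (U : set config) : open U ->
  U = \bigcup_(s in [set s | scyl s `<=` U]) scyl s.
Proof.
move=> oU; apply/seteqP; split=> eta; last by move=> [s /= sU /sU].
move=> Ueta; have [A AU] : exists A, cyl A eta `<=` U.
  by apply: nbhs_cyl; apply: open_nbhs_nbhs.
by exists [seq (x, eta x) | x <- A]; rewrite /= -cyl_scyl.
Qed.

(** The type [seq (site * bool)] is countable, so an open set, being a union of [scyl] sets, is a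
    countable one. Indexing by lists of constraints rather than by configurations is what gives a
    countable generator. *)
Lemma sigma_scyl : <<s range scyl >> = (measurable : set (set borel_config)).
Proof.
apply/seteqP; split.
  apply: smallest_sub; first exact: sigma_algebra_measurable.
  move=> _ [s _ <-]; have [->|[A _ [c ->]]] := scylP s; first exact: measurable0.
  exact: measurable_cyl.
apply: smallest_sub; first exact: smallest_sigma_algebra.
move=> U /open_bigcup_scyl ->.
rewrite bigcup_mkcond.
apply: (@countable_bigcupT_measurable _ (g_sigma_algebraType (range scyl))); first exact: countableP.
move=> s; case: ifPn => _; last exact: measurable0.
by apply: sub_sigma_algebra; exists s.
Qed.

(** Uniqueness on a pi-system: concatenating lists intersects [scyl] sets, the empty list gives the
    whole space, and by [scylP] each such set is empty or a genuine cylinder. *)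
Lemma measure_eq_cyl (R : realType) (m1 m2 : {measure set borel_config -> \bar R}) :
  (m1 setT < +oo)%E ->
  (forall A c, uniq A -> m1 (cyl A c) = m2 (cyl A c)) ->
  forall B : set borel_config, measurable B -> m1 B = m2 B.
Proof.
move=> fin H B mB.
apply: (@measure_unique _ R borel_config (range scyl) (fun=> setT) _ _ _ _ m1 m2 _ _ B mB) => //.
- by rewrite sigma_scyl.
- move=> _ _ [s _ <-] [t _ <-]; exists (s ++ t) => //.
  apply/seteqP; split=> eta /=.
    by move=> h; split=> e es; apply: h; rewrite mem_cat es ?orbT.
  by move=> [h1 h2] e; rewrite mem_cat => /orP[/h1|/h2].
- by move=> i; exists [::] => //; apply/seteqP; split.
- by apply/seteqP; split=> // x _; exists 0%N.
- move=> _ [s _ <-]; have [->|[A uA [c ->]]] := scylP s; first by rewrite !measure0.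
  exact: H.
Qed.

(** * Expectations *)

Section expectation.
Context {R : realType}.
Implicit Types (f g : config -> R) (A B : seq site).

Definition dep A f := forall eta zeta : config, {in A, eta =1 zeta} -> f eta = f zeta.

Lemma dep_sub A B f : {subset A <= B} -> dep A f -> dep B f.
Proof. by move=> AB df eta zeta H; apply: df => x /AB; exact: H. Qed.

Lemma dep_continuous A f : dep A f -> continuous f.
Proof.
move=> df eta; apply: cvg_near_cst.
have : nbhs eta (cyl A eta) by apply: open_nbhs_nbhs; split => //; exact: cyl_open.
by apply: filterS => z zA; exact: df.
Qed.

Lemma continuous_bounded f : continuous f -> exists2 M, 0 <= M & forall eta, `|f eta| <= M.
Proof.
move=> cf; have /compact_bounded[M [_ HM]] : compact (f @` [set: config]).
  apply: continuous_compact; last exact: config_compact.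
  exact: continuous_subspaceT.
have HM1 : M < `|M| + 1 by rewrite (le_lt_trans (ler_norm _)) ?ltrDl.
exists (`|M| + 1); first by rewrite addr_ge0.
by move=> eta; apply: (HM _ HM1); exists eta.
Qed.

(** Uniform continuity from compactness: finitely many cylinders on which [f] stays within [e / 2]
    of its value at the centre cover the space, and their supports together form [A]. *)
Lemma continuous_local f : continuous f -> forall e, 0 < e ->
  exists A, forall eta zeta : config, {in A, eta =1 zeta} -> `|f eta - f zeta| < e.
Proof.
move=> cf e e0.
have e20 : 0 < e / 2 by rewrite divr_gt0.
have /choice[N HN] : forall eta : config, exists A, cyl A eta `<=` [set z | `|f eta - f z| < e / 2].
  move=> eta.
  apply: nbhs_cyl; have /cvgrPdist_lt := cf eta; exact.
have := config_compact; rewrite compact_cover => /(_ config setT (fun eta => cyl (N eta) eta)).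
case; first by move=> eta _; exact: cyl_open.
  by move=> eta _; exists eta.
move=> D _ HD; exists (flatten [seq N eta | eta <- finmap.enum_fset D]) => eta zeta H.
have [c /= cD ceta] := HD eta I.
have Nc x : x \in N c -> x \in flatten [seq N eta | eta <- finmap.enum_fset D].
  by move=> xN; apply/flatten_mapP; exists c.
have h1 : `|f c - f eta| < e / 2 by apply: HN.
have h2 : `|f c - f zeta| < e / 2.
  by apply: HN => x xN; rewrite -H ?Nc//; exact: ceta.
rewrite (splitr e); have -> : f eta - f zeta = (f c - f zeta) - (f c - f eta) by ring.
by rewrite (le_lt_trans (ler_normB _ _))// ltrD.
Qed.

Definition restr A (eta : config) : config := fun x => (x \in A) && eta x.

Lemma continuous_cylinder_approx f : continuous f -> forall e, 0 < e ->
  exists A, exists2 h, dep A h & forall eta, `|f eta - h eta| < e.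
Proof.
move=> cf e e0; have [A HA] := continuous_local cf e0.
exists A, (fun eta => f (restr A eta)).
  move=> eta zeta H; congr f; apply/funext => x; rewrite /restr.
  by have [/H ->|] := boolP (x \in A).
by move=> eta; apply: HA => x xA; rewrite /restr xA.
Qed.

Lemma continuous_measurable f : continuous f -> measurable_fun setT (f : borel_config -> R).
Proof.
move=> cf; apply: (measurability _ (RGenOpens.measurableE R)).
move=> _ [_ [a [b ->]] <-]; rewrite setTI; apply: sub_sigma_algebra.
by apply: open_comp => // x _; exact: cf.
Qed.

Lemma continuous_add f g : continuous f -> continuous g -> continuous (fun eta => f eta + g eta).
Proof. by move=> cf cg eta; apply: cvgD; [exact: cf|exact: cg]. Qed.

Lemma continuous_scale (a : R) f : continuous f -> continuous (fun eta => a * f eta).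
Proof. by move=> cf eta; apply: cvgM; [exact: cvg_cst|exact: cf]. Qed.

Lemma continuous_sub f g : continuous f -> continuous g -> continuous (fun eta => f eta - g eta).
Proof. by move=> cf cg eta; apply: cvgB; [exact: cf|exact: cg]. Qed.

Lemma continuous_cst (a : R) : continuous (fun _ : config => a).
Proof. by move=> eta; exact: cvg_cst. Qed.

Variable mu : probability borel_config R.

Definition ev f : R := Rintegral mu setT f.

Lemma integrable_continuous f : continuous f ->
  mu.-integrable setT (EFin \o (f : borel_config -> R)).
Proof.
move=> cf; apply: measurable_bounded_integrable => //.
- by rewrite -ge0_fin_numE// fin_num_measure.
- exact: continuous_measurable.
have [M M0 HM] := continuous_bounded cf.
by exists M; split => [|x Mx eta _]; [exact: num_real|exact: le_trans (HM _) (ltW Mx)].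
Qed.

Lemma expectation_ev f : continuous f -> ('E_mu[f] = (ev f)%:E)%E.
Proof.
move=> cf; rewrite /ev /Rintegral fineK; first by rewrite unlock.
exact: integrable_fin_num (integrable_continuous cf).
Qed.

Lemma ev_add f g : continuous f -> continuous g -> ev (fun eta => f eta + g eta) = ev f + ev g.
Proof. by move=> cf cg; apply: RintegralD => //; exact: integrable_continuous. Qed.

Lemma ev_sub f g : continuous f -> continuous g -> ev (fun eta => f eta - g eta) = ev f - ev g.
Proof. by move=> cf cg; apply: RintegralB => //; exact: integrable_continuous. Qed.

Lemma ev_scale a f : continuous f -> ev (fun eta => a * f eta) = a * ev f.
Proof. by move=> cf; apply: RintegralZl => //; exact: integrable_continuous. Qed.

Lemma ev_cst a : ev (fun=> a) = a.
Proof.  rewrite /ev Rintegral_cst// -[RHS]mulr1; congr (_ * _).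
have -> : 1 = fine (1%E : \bar R) by [].
by congr fine; exact: probability_setT. Qed.

Lemma ev_le f g : continuous f -> continuous g -> (forall eta, f eta <= g eta) -> ev f <= ev g.
Proof. by move=> cf cg H; apply: le_Rintegral => //; exact: integrable_continuous. Qed.

Lemma ev_norm f M : continuous f -> (forall eta, `|f eta| <= M) -> `|ev f| <= M.
Proof.
move=> cf H; rewrite ler_norml -{1}(ev_cst (- M)) -{2}(ev_cst M).
by apply/andP; split; apply: ev_le => //; try exact: continuous_cst;
  move=> eta; have := H eta; rewrite ler_norml => /andP[].
Qed.

Lemma ev_ge0 f : (forall eta, 0 <= f eta) -> 0 <= ev f.
Proof. by move=> H; apply: Rintegral_ge0. Qed.

Lemma continuous_sum (I : Type) (s : seq I) (F : I -> config -> R) :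
  (forall i, continuous (F i)) -> continuous (fun eta => \sum_(i <- s) F i eta).
Proof.
move=> cF; elim: s => [|i s IH].
  rewrite (_ : (fun _ => _) = (fun=> 0)); first exact: continuous_cst.
  by apply/funext => eta; rewrite big_nil.
rewrite (_ : (fun _ => _) = (fun eta => F i eta + \sum_(j <- s) F j eta)); first exact: continuous_add.
by apply/funext => eta; rewrite big_cons.
Qed.

Lemma ev_sum (I : Type) (s : seq I) (F : I -> config -> R) :
  (forall i, continuous (F i)) ->
  ev (fun eta => \sum_(i <- s) F i eta) = \sum_(i <- s) ev (F i).
Proof.
move=> cF; elim: s => [|i s IH].
  rewrite big_nil -[RHS](ev_cst 0); congr ev.
  by apply/funext => eta; rewrite big_nil.
rewrite big_cons -IH -ev_add//; last exact: continuous_sum.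
by congr ev; apply/funext => eta; rewrite big_cons.
Qed.

Definition pr A (c : config) : R := fine (mu (cyl A c)).

Lemma pr_ge0 A c : 0 <= pr A c.
Proof. by rewrite /pr fine_ge0. Qed.

Lemma prE A c : mu (cyl A c) = (pr A c)%:E.
Proof. by rewrite /pr fineK// fin_num_measure//; exact: measurable_cyl. Qed.

Definition indc A (c : config) (eta : config) : R := (`[< cyl A c eta >])%:R.

Lemma dep_indc A c : dep A (indc A c).
Proof.
move=> eta zeta H; rewrite /indc; congr (nat_of_bool _)%:R.
apply/asbool_equiv_eq; split => E x xA; first by rewrite -H// E.
by rewrite H// E.
Qed.

Lemma ev_indc A c : ev (indc A c) = pr A c.
Proof.
have mA := measurable_cyl A c.
rewrite /ev /Rintegral /pr -[in RHS](setIT (cyl A c : set borel_config)) -integral_indic//.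
Qed.

End expectation.

(** * Finite sums over configurations *)

Definition upd (c : config) (x : site) (b : bool) : config :=
  fun z => if z == x then b else c z.

(** A pattern on [A] is represented by the configuration that is empty off [A]; expectations of
    functions of finitely many sites become finite sums over this list. *)
Fixpoint cfgs (A : seq site) : seq config :=
  if A is x :: A' then
    [seq upd c x false | c <- cfgs A'] ++ [seq upd c x true | c <- cfgs A']
  else [:: (fun=> false) : config].

Lemma mem_cfgs A (c : config) : (c \in cfgs A) <-> (forall z, z \notin A -> c z = false).
Proof.
elim: A c => [|x A IH] c /=.
  rewrite inE; split => [/eqP -> //|H]; apply/eqP/funext => z; exact: H.
rewrite mem_cat; split.
  move=> /orP[] /mapP[c' /IH H ->] z; rewrite inE negb_or => /andP[/negbTE zx zA];
  by rewrite /upd zx H.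
move=> H; have cA : upd c x false \in cfgs A.
  apply/IH => z zA; rewrite /upd; case: eqP => // /eqP zx.
  by apply: H; rewrite inE negb_or zx.
have cE : c = upd (upd c x false) x (c x).
  by apply/funext => z; rewrite /upd; case: eqP => // ->.
apply/orP; case: (c x) cE => cE; [right|left]; by apply/mapP; exists (upd c x false).
Qed.

Lemma cfgs_uniq A : uniq A -> uniq (cfgs A).
Proof.
elim: A => [|x A IH] //= /andP[xA uA]; rewrite cat_uniq.
have inj b : {in cfgs A &, injective (fun c => upd c x b)}.
  move=> c c' /mem_cfgs Hc /mem_cfgs Hc' E; apply/funext => z.
  have := congr1 (fun c : config => c z) E; rewrite /upd; case: eqP => // -> _.
  by rewrite Hc// Hc'.
rewrite !map_inj_in_uniq ?IH//= andbT; apply/hasPn => c /mapP[c1 _ ->].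
apply/negP => /mapP[c2 _] /(congr1 (fun c : config => c x)).
by rewrite /upd eqxx.
Qed.

Lemma restr_cfgs A (eta : config) : restr A eta \in cfgs A.
Proof. by apply/mem_cfgs => z zA; rewrite /restr (negbTE zA). Qed.

Definition swp (x y z : site) : site := if z == x then y else if z == y then x else z.

Lemma swpK x y : involutive (swp x y).
Proof.
move=> z; rewrite /swp; have [->|zx] := eqVneq z x; first by rewrite eqxx; case: eqP.
have [->|zy] := eqVneq z y; first by rewrite eqxx.
by rewrite (negbTE zx) (negbTE zy).
Qed.

Lemma swp_l x y : swp x y x = y. Proof. by rewrite /swp eqxx. Qed.
Lemma swp_r x y : swp x y y = x. Proof. by rewrite /swp eqxx; case: eqP. Qed.
Lemma swp_n x y z : z != x -> z != y -> swp x y z = z.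
Proof. by rewrite /swp => /negbTE -> /negbTE ->. Qed.
Lemma swpC x y : swp x y = swp y x.
Proof. by apply/funext => z; rewrite /swp; have [->|] := eqVneq z x; case: eqP => // ->. Qed.

Lemma mem_swp x y z (A : seq site) : x \in A -> y \in A -> (swp x y z \in A) = (z \in A).
Proof.
by move=> xA yA; rewrite /swp; case: eqP => [->|_]; [rewrite xA yA|case: eqP => // ->; rewrite xA yA].
Qed.

Definition sw (x y : site) (eta : config) : config := fun z => eta (swp x y z).

Lemma swK x y (eta : config) : sw x y (sw x y eta) = eta.
Proof. by apply/funext => z; rewrite /sw swpK. Qed.

Lemma swC x y (eta : config) : sw x y eta = sw y x eta.
Proof. by rewrite /sw swpC. Qed.

(** Unlike a move, an exchange of contents is an involution of the whole space, hence available as a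
    change of variables. *)
Lemma move_particle_sw (eta : config) x y : x != y -> eta x -> ~~ eta y -> move_particle eta x y = sw x y eta.
Proof.
move=> xy ex ey; apply/funext => z; rewrite /move_particle /sw /swp.
have [->|zy] := eqVneq z y; first by rewrite eq_sym (negbTE xy) ex.
by have [_|] := eqVneq z x; first rewrite (negbTE ey).
Qed.

Definition flip (x : site) (eta : config) : config := upd eta x (~~ eta x).

Lemma flipK x (eta : config) : flip x (flip x eta) = eta.
Proof.
apply/funext => z; rewrite /flip /upd; have [->|//] := eqVneq z x.
by rewrite eqxx negbK.
Qed.

(** The conditions under which [s] permutes the patterns on [A], so that sums over [cfgs A] can be
    reindexed by it. *)
Definition local_involution (A : seq site) (s : config -> config) :=
  [/\ involutive s, forall c c' : config, {in A, c =1 c'} -> {in A, s c =1 s c'} &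
   forall c : config, c \in cfgs A -> s c \in cfgs A].

Lemma sw_local A x y : x \in A -> y \in A -> local_involution A (sw x y).
Proof.
move=> xA yA; split; first exact: swK.
  by move=> c c' H z zA; rewrite /sw H// mem_swp.
by move=> c /mem_cfgs H; apply/mem_cfgs => z zA; apply: H; rewrite mem_swp.
Qed.

Lemma flip_local A x : x \in A -> local_involution A (flip x).
Proof.
move=> xA; split; first exact: flipK.
  by move=> c c' H z zA; rewrite /flip /upd; case: eqP => _; rewrite H.
move=> c /mem_cfgs H; apply/mem_cfgs => z zA; rewrite /flip /upd; case: eqP => [zx|_].
  by move: zA; rewrite zx xA.
exact: H.
Qed.

Section finite_sums.
Context {R : realType}.
Implicit Types (f g : config -> R) (A B : seq site).

Lemma dep_sum_indc A f eta : uniq A -> dep A f ->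
  f eta = \sum_(c <- cfgs A) f c * indc A c eta.
Proof.
move=> uA df; rewrite (bigD1_seq (restr A eta)) ?restr_cfgs ?cfgs_uniq//=.
rewrite big_seq_cond big1 ?addr0; last first.
  move=> c /andP[/mem_cfgs H cr]; rewrite /indc asboolF ?mulr0// => E.
  move/eqP: cr; apply; apply/funext => z; rewrite /restr.
  by have [/E|/H] := boolP (z \in A).
rewrite /indc asboolT ?mulr1; last by move=> z zA; rewrite /restr zA.
by apply: df => z zA; rewrite /restr zA.
Qed.

Lemma sum_cfgs_involution A s (F : config -> R) : uniq A -> local_involution A s ->
  \sum_(c <- cfgs A) F (s c) = \sum_(c <- cfgs A) F c.
Proof.
move=> uA [sK _ sc]; rewrite -(big_map s xpredT F); apply: perm_big.
apply: uniq_perm; rewrite ?map_inj_uniq ?cfgs_uniq//; first exact: inv_inj.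
move=> c; apply/idP/idP => [/mapP[c' + ->]|cA]; first exact: sc.
by apply/mapP; exists (s c); rewrite ?sK//; exact: sc.
Qed.

Variable mu : probability borel_config R.

Lemma ev_dep A f : uniq A -> dep A f -> ev mu f = \sum_(c <- cfgs A) f c * pr mu A c.
Proof.
move=> uA df; transitivity (ev mu (fun eta => \sum_(c <- cfgs A) f c * indc A c eta)).
  by congr ev; apply/funext => eta; exact: dep_sum_indc.
have ci c : continuous (@indc R A c) by exact: (dep_continuous (@dep_indc R A c)).
rewrite ev_sum; last by move=> c; exact: continuous_scale.
by apply: eq_bigr => c _; rewrite ev_scale// ev_indc.
Qed.

Lemma dep_pr A : dep A (pr mu A).
Proof. by move=> eta zeta H; rewrite /pr (eq_cyl H). Qed.

(** The factor is the density on [A] of the image of [mu] under [s]: positivity cancels the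
    denominator in the sum over patterns, and reindexing by [s] does the rest. *)
Lemma change_var A s g : uniq A -> local_involution A s -> (forall c, 0 < pr mu A c) ->
  dep A g -> ev mu (fun eta => g eta * (pr mu A (s eta) / pr mu A eta)) = ev mu (g \o s).
Proof.
move=> uA loc pos dg; have [sK sA sc] := loc.
rewrite !(@ev_dep A)//; last 2 first.
- by move=> c c' H; apply: dg; exact: sA.
- move=> c c' H; rewrite (dg _ _ H) (dep_pr H) (dep_pr (sA _ _ H)) //.
transitivity (\sum_(c <- cfgs A) g c * pr mu A (s c)).
  by apply: eq_bigr => c _; rewrite -mulrA divfK// gt_eqF.
rewrite -(sum_cfgs_involution _ uA loc); apply: eq_bigr => c _ /=.
by rewrite sK.
Qed.

End finite_sums.

(** * Stationarity in terms of the generator *)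

Lemma uniform_cvg_dist (R : realType) (F : set_system (config -> R)) (f : config -> R) :
  {uniform, F --> f} -> forall e, 0 < e ->
  F [set h | forall eta, `|f eta - h eta| < e].
Proof.
move=> H e e0; apply: H; apply/uniform_nbhs.
exists [set xy | `|xy.1 - xy.2| < e]; split; first exact: entourage_ball (PosNum e0).
by move=> h /= Hh eta; exact: Hh.
Qed.

Lemma uniform_cvg_cst (R : realType) (f : config -> R) :
  {uniform, (fun _ : nat => f) @ \oo --> f}.
Proof.
move=> U /= /uniform_nbhs[E [entE EU]]; exists 0%N => // n _ /=.
by apply: EU => eta _; exact: entourage_refl.
Qed.

Section semigroup.
Context {R : realType}.
Variables (S : R -> (config -> R) -> config -> R).
Hypothesis HS : markov_semigroup S.
Implicit Types (f g : config -> R) (t s : R).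

Lemma semigroup_cst0 t : 0 <= t -> S t (fun=> 0) = (fun=> 0).
Proof.
move=> t0; have c0 := @continuous_cst R 0.
have := semigroup_linear HS (-1) t0 c0 c0.
rewrite mulr0 addr0 => ->; apply/funext => eta.
by rewrite mulN1r addNr.
Qed.

Lemma semigroup_scale t a f : 0 <= t -> continuous f ->
  S t (fun eta => a * f eta) = (fun eta => a * S t f eta).
Proof.
move=> t0 cf; have := semigroup_linear HS a t0 cf (@continuous_cst R 0).
rewrite semigroup_cst0//.
under [X in S t X]eq_fun do rewrite addr0.
by under [X in _ = X -> _]eq_fun do rewrite addr0.
Qed.

Lemma semigroup_sub t f g : 0 <= t -> continuous f -> continuous g ->
  S t (fun eta => f eta - g eta) = (fun eta => S t f eta - S t g eta).
Proof.
move=> t0 cf cg; have := semigroup_linear HS (-1) t0 cg cf.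
under [X in S t X]eq_fun do rewrite mulN1r addrC.
by under [X in _ = X -> _]eq_fun do rewrite mulN1r addrC.
Qed.

Lemma semigroup_cst t a : 0 <= t -> S t (fun=> a) = (fun=> a).
Proof.
move=> t0; have := semigroup_scale a t0 (@continuous_cst R 1).
have /= -> := semigroup1 HS t0.
under [X in S t X]eq_fun do rewrite mulr1.
by under [X in _ = X -> _]eq_fun do rewrite mulr1.
Qed.

Lemma semigroup_le t f g : 0 <= t -> continuous f -> continuous g ->
  (forall eta, f eta <= g eta) -> forall eta, S t f eta <= S t g eta.
Proof.
move=> t0 cf cg fg eta; rewrite -subr_ge0.
have -> : S t g eta - S t f eta = S t (fun eta => g eta - f eta) eta by rewrite semigroup_sub.
apply: (semigroup_ge0 HS) => //; first exact: continuous_sub.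
by move=> z; rewrite subr_ge0.
Qed.

Lemma semigroup_norm t f M : 0 <= t -> continuous f ->
  (forall eta, `|f eta| <= M) -> forall eta, `|S t f eta| <= M.
Proof.
move=> t0 cf H eta; rewrite ler_norml.
have := semigroup_cst (- M) t0 => /(congr1 (fun f => f eta)) <-.
have := semigroup_cst M t0 => /(congr1 (fun f => f eta)) E; rewrite -{2}E {E}.
by apply/andP; split; apply: semigroup_le => //; try exact: continuous_cst;
  move=> z; have := H z; rewrite ler_norml => /andP[].
Qed.

Lemma markov_generator_near f g : markov_generator S f g -> forall e, 0 < e ->
  exists2 d, 0 < d & forall s, 0 < s -> s < d ->
    forall eta, `|g eta - s^-1 * (S s f eta - f eta)| < e.
Proof.
move=> [_ _ H] e e0; have := uniform_cvg_dist H e0.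
move=> /nbhs_ballP[d /= d0 Hd]; exists d => // s s0 sd; apply: Hd => //.
by rewrite /ball/= sub0r normrN gtr0_norm.
Qed.

(** [S t] commutes with [S s] and is a contraction for the uniform norm, so it carries the
    difference quotients of [f], with their rate of convergence, to those of [S t f]. *)
Lemma markov_generator_semigroup f g t : 0 <= t -> markov_generator S f g ->
  markov_generator S (S t f) (S t g).
Proof.
move=> t0 fg; have [cf cg _] := fg; split; [exact: semigroup_continuous..|].
move=> U /= /uniform_nbhs[E [entE EU]].
have [e /= e0 He] : exists2 e, 0 < e & forall x y : R, `|x - y| < e -> E (x, y).
  move: entE; rewrite -entourage_ballE => -[e /= e0 He]; exists e => // x y xy.
  exact: He.
have [d d0 Hd] := markov_generator_near fg (divr_gt0 e0 (ltr0n R 2)).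
rewrite nbhs_simpl /=.
apply/nbhs_ballP; exists d => //= s; rewrite /ball/= sub0r normrN => sd s0.
apply: EU => eta _ /=; apply: He.
rewrite gtr0_norm// in sd.
have cSf : continuous (S s f) by apply: (semigroup_continuous HS) => //; exact: ltW.
have cD : continuous (fun eta => S s f eta - f eta) by exact: continuous_sub.
have <- : S t (S s f) eta = S s (S t f) eta.
  by rewrite -(semigroupD HS)// ?ltW// addrC (semigroupD HS)// ltW.
have -> : s^-1 * (S t (S s f) eta - S t f eta) = S t (fun eta => s^-1 * (S s f eta - f eta)) eta.
  by rewrite semigroup_scale// semigroup_sub.
have -> : S t g eta - S t (fun eta => s^-1 * (S s f eta - f eta)) eta =
  S t (fun eta => g eta - s^-1 * (S s f eta - f eta)) eta.
  by rewrite semigroup_sub//; exact: continuous_scale.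
apply: (@le_lt_trans _ _ (e / 2)); last by rewrite ltr_pdivrMr// ltr_pMr// ltr1n.
apply: semigroup_norm => //; first by apply: continuous_sub => //; exact: continuous_scale.
by move=> z; apply/ltW/Hd.
Qed.

Variable mu : probability borel_config R.

Lemma invariantP : invariant_measures S mu <->
  (forall t f, 0 <= t -> continuous f -> ev mu (S t f) = ev mu f).
Proof.
split=> H t f t0 cf.
  by have := H t f t0 cf; rewrite !expectation_ev//; [case|exact: (semigroup_continuous HS)].
by rewrite !expectation_ev//; [rewrite H|exact: (semigroup_continuous HS)].
Qed.

(** An invariant [mu] integrates every difference quotient of [f] to 0, and these converge uniformly
    to [g]. *)
Lemma invariant_generator f g : invariant_measures S mu ->
  markov_generator S f g -> ev mu g = 0.
Proof.
move=> /invariantP I fg; have [cf cg _] := fg.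
apply/eqP; rewrite -normr_le0; apply/ler_addgt0Pl => e e0; rewrite addr0.
have [d d0 Hd] := markov_generator_near fg e0.
have d20 : 0 < d / 2 by rewrite divr_gt0.
have d2d : d / 2 < d by rewrite ltr_pdivrMr// ltr_pMr// ltr1n.
have cS : continuous (S (d / 2) f) by apply: (semigroup_continuous HS) => //; exact: ltW.
have cD : continuous (fun eta => (d / 2)^-1 * (S (d / 2) f eta - f eta)).
  by apply: continuous_scale; exact: continuous_sub.
have -> : ev mu g = ev mu (fun eta => g eta - (d / 2)^-1 * (S (d / 2) f eta - f eta)).
  rewrite ev_sub// ev_scale; last exact: continuous_sub.
  by rewrite ev_sub// I ?ltW// subrr mulr0 subr0.
apply: ev_norm; first exact: continuous_sub.
by move=> eta; apply/ltW/Hd.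
Qed.

(** Discrete form of the fact that [ev mu (S t h)] has derivative [ev mu (S t g) = 0]: [[0, t]] is
    cut into steps of length [s], each changing the mean by at most [s * (e / t)]. The first
    hypothesis covers all pairs of the generator because [S t h] may fail to be a cylinder
    function. *)
Lemma generator_invariant :
  (forall f g, markov_generator S f g -> ev mu g = 0) ->
  (forall f, cylinder_function f -> exists g, markov_generator S f g) ->
  invariant_measures S mu.
Proof.
move=> H0 core; apply/invariantP => t f t0 cf.
have [->|tN0] := eqVneq t 0; first by rewrite (semigroup0 HS).
have tp : 0 < t by rewrite lt_def tN0.
have cyl_inv h : cylinder_function h -> ev mu (S t h) = ev mu h.
  move=> /core [g hg]; have [ch cg _] := hg.
  apply/eqP; rewrite -subr_eq0 -normr_le0; apply/ler_addgt0Pl => e e0; rewrite addr0.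
  have et0 : 0 < e / t by rewrite divr_gt0.
  have [d d0 Hd] := markov_generator_near hg et0.
  (* [N] makes the step [s = t / N] shorter than [d], so the difference quotient of [h] at [s] is
     within [e / t] of [g]. *)
  pose N := Num.bound (t / d); pose s := t / N%:R.
  have N0 : (0 : R) < N%:R.
    by apply: (@le_lt_trans _ _ (t / d)); [rewrite divr_ge0// ltW|apply: archi_boundP; rewrite divr_ge0// ltW].
  have s0 : 0 < s by rewrite divr_gt0.
  have sd : s < d.
    rewrite /s ltr_pdivrMr// mulrC -ltr_pdivrMr//.
    by apply: archi_boundP; rewrite divr_ge0// ltW.
  have ks0 k : 0 <= k%:R * s by rewrite mulr_ge0// ltW.
  suff step k : `|ev mu (S (k%:R * s) h) - ev mu h| <= k%:R * s * (e / t).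
    have := step N; have -> : N%:R * s = t by rewrite /s mulrC divfK// gt_eqF.
    by rewrite mulrC divfK// gt_eqF.
  elim: k => [|k IH]; first by rewrite !mul0r (semigroup0 HS)// subrr normr0.
  have cSs : continuous (S s h) by apply: (semigroup_continuous HS) => //; exact: ltW.
  have cSk := semigroup_continuous HS (ks0 k).
  have cD : continuous (fun eta => g eta - s^-1 * (S s h eta - h eta)).
    by apply: continuous_sub => //; apply: continuous_scale; exact: continuous_sub.
  (* Write [S s h] as [h + s g] minus [s] times the error of the difference quotient. After applying
     [S (k s)] the term in [g] has mean 0, since [S (k s) g] is the generator at [S (k s) h]. *)
  have -> : ev mu (S (k.+1%:R * s) h) - ev mu h =
     (ev mu (S (k%:R * s) h) - ev mu h)
     - s * ev mu (S (k%:R * s) (fun eta => g eta - s^-1 * (S s h eta - h eta))).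
    rewrite semigroup_sub//; last by apply: continuous_scale; exact: continuous_sub.
    rewrite semigroup_scale//; last exact: continuous_sub.
    rewrite semigroup_sub// ev_sub; [|exact: cSk|apply: continuous_scale; apply: continuous_sub; exact: cSk].
    rewrite ev_scale; last by apply: continuous_sub; exact: cSk.
    rewrite ev_sub; [|exact: cSk..].
    rewrite (H0 (S (k%:R * s) h) (S (k%:R * s) g)); last exact: markov_generator_semigroup.
    rewrite -(semigroupD HS)// ?ltW//.
    rewrite -[in k.+1]addn1 natrD mulrDl mul1r.
    by field; rewrite gt_eqF.
  apply: (le_trans (ler_normB _ _)).
  rewrite -[in k.+1]addn1 natrD !mulrDl mul1r lerD//.
  rewrite normrM gtr0_norm// ler_pM2l//.
  apply: ev_norm; first exact: cSk.
  by apply: semigroup_norm => // z; apply/ltW/Hd.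
(* From cylinder functions to continuous ones: [f] is within [e / 2] of a cylinder function, and the
   contraction [S t] does not enlarge this error. *)
apply/eqP; rewrite -subr_eq0 -normr_le0; apply/ler_addgt0Pl => e e0; rewrite addr0.
have [A [h dh Hh]] := continuous_cylinder_approx cf (divr_gt0 e0 (ltr0n R 2)).
have ch := dep_continuous dh.
have -> : ev mu (S t f) - ev mu f = ev mu (S t (fun eta => f eta - h eta)) - ev mu (fun eta => f eta - h eta).
  rewrite semigroup_sub// !ev_sub//; try exact: (semigroup_continuous HS).
  rewrite (cyl_inv h); first by ring.
  by exists A.
have cfh := continuous_sub cf ch.
rewrite (le_trans (ler_normB _ _))// (splitr e) lerD//; apply: ev_norm => //.
- exact: (semigroup_continuous HS).
- by apply: semigroup_norm => // z; apply/ltW/Hh.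
- by move=> z; apply/ltW/Hh.
Qed.

End semigroup.

Section sep_invariance.
Context {R : realType}.
Variables (p q d0 l0 d1 l1 : R) (S : R -> (config -> R) -> config -> R).
Hypothesis HS : sep_semigroup p q d0 l0 d1 l1 S.

Lemma cylinder_generator f : cylinder_function f ->
  markov_generator S f (pregenerator p q d0 l0 d1 l1 f).
Proof. move=> cf; apply: (proj2 (HS.2 _ _)); exists (fun=> f); split => //; exact: uniform_cvg_cst. Qed.

(** For the converse, the second component of a pair of the generator is a uniform limit of images
    of cylinder functions, so the vanishing of the mean extends to the whole generator. *)
Lemma sep_invariantP (mu : probability borel_config R) : invariant_measures S mu <->
  (forall f, cylinder_function f -> ev mu (pregenerator p q d0 l0 d1 l1 f) = 0).
Proof.
split=> [I f cf|I]; first exact: (invariant_generator HS.1 I (cylinder_generator cf)).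
apply: (generator_invariant HS.1); last first.
  by move=> f cf; exists (pregenerator p q d0 l0 d1 l1 f); exact: cylinder_generator.
move=> f g fg; have [cf cg _] := fg.
have [h [ch _ hg]] := proj1 (HS.2 _ _) fg.
apply/eqP; rewrite -normr_le0; apply/ler_addgt0Pl => e e0; rewrite addr0.
have Hnear : \forall n \near \oo, forall eta, `|g eta - pregenerator p q d0 l0 d1 l1 (h n) eta| < e.
  exact: (uniform_cvg_dist hg e0).
have [n Hn] := filter_ex Hnear.
have [_ cLh _] := cylinder_generator (ch n).
have -> : ev mu g = ev mu (fun eta => g eta - pregenerator p q d0 l0 d1 l1 (h n) eta).
  by rewrite ev_sub// I// subr0.
apply: ev_norm; first exact: continuous_sub.
by move=> eta; exact/ltW/Hn.
Qed.

End sep_invariance.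

(** * The generator in a box *)

Definition box (c : int) (n : nat) : seq site :=
  [seq (c + k%:Z, i) | k <- iota 0 n, i <- [:: false; true]].

Arguments box : simpl never.

Lemma mem_box c n (x : site) : (x \in box c n) = (c <= x.1 < c + n%:Z).
Proof.
apply/allpairsP/idP => [[[k i] /= [+ _ ->]]|/andP[h1 h2]].
  by rewrite mem_iota /= => kn; lia.
exists (`|x.1 - c|%N, x.2) => /=; split.
- by rewrite mem_iota; lia.
- by case: (x.2).
- by case: x h1 h2 => z i /= h1 h2; congr pair; lia.
Qed.

Lemma box_uniq c n : uniq (box c n).
Proof.
apply: allpairs_uniq; [exact: iota_uniq|by []|].
by move=> [k i] [k' i'] _ _ /= [] h ->; congr pair; lia.
Qed.

Section generator_sum.
Context {R : realType}.
Variables (p q d0 l0 d1 l1 : R).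
Implicit Types (f : config -> R) (eta : config) (x y : site) (c : int) (n : nat).

Definition dd (i : bool) : R := if i then d1 else d0.
Definition ll (i : bool) : R := if i then l1 else l0.

Definition jp x y eta : R := (eta x)%:R * (1 - (eta y)%:R).

Definition jump x y f eta : R := jp x y eta * (f (sw x y eta) - f eta).

(** Bond [k] joins columns [c + k - 1] and [c + k]. For a box of [n] columns [k] runs from 0 to [n]
    inclusive, and exactly the bonds 0 and [n] stick out of the box. *)
Definition hedge c (t : nat * bool * bool) : site * site :=
  let: (k, i, b) := t in
  if b then ((c + k%:Z - 1, i), (c + k%:Z, i)) else ((c + k%:Z, i), (c + k%:Z - 1, i)).

Definition vedge c (t : nat * bool) : site * site :=
  let: (k, b) := t in ((c + k%:Z, ~~ b), (c + k%:Z, b)).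

Definition hedges c n : seq (site * site) :=
  [seq hedge c t | t <-
    [seq (t, b) | t <- [seq (k, i) | k <- iota 0 n.+1, i <- [:: false; true]], b <- [:: true; false]]].

Definition vedges c n : seq (site * site) :=
  [seq vedge c t | t <- [seq (k, b) | k <- iota 0 n, b <- [:: true; false]]].

Arguments hedges : simpl never.
Arguments vedges : simpl never.

Lemma hedges_uniq c n : uniq (hedges c n).
Proof.
rewrite map_inj_uniq; first by do 2 (apply: allpairs_uniq => //; last by move=> [? ?] [? ?]); exact: iota_uniq.
by move=> [[k i] []] [[k' i'] []] /= [] ? ? ?; try lia; move=> ?; congr (_, _, _); lia.
Qed.

Lemma vedges_uniq c n : uniq (vedges c n).
Proof.
rewrite map_inj_uniq; first by apply: allpairs_uniq => //; [exact: iota_uniq|move=> [? ?] [? ?]].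
by move=> [k b] [k' b'] /= [] ? ? ? ?; congr pair; lia.
Qed.

Lemma mem_hedges c n k i b : (k <= n)%N -> hedge c (k, i, b) \in hedges c n.
Proof.
move=> kn; apply: (map_f (hedge c)); apply/allpairsP; exists ((k, i), b); split; [ |by case: b|by []].
apply/allpairsP; exists (k, i); split; [ |by case: i|by []].
by rewrite mem_iota /=; lia.
Qed.

Lemma mem_vedges c n k b : (k < n)%N -> vedge c (k, b) \in vedges c n.
Proof.
move=> kn; apply: (map_f (vedge c)); apply/allpairsP; exists (k, b); split; [ |by case: b|by []].
by rewrite mem_iota /=; lia.
Qed.

Lemma edges_uniq c n : uniq (hedges c n ++ vedges c n).
Proof.
rewrite cat_uniq hedges_uniq vedges_uniq andbT /=; apply/hasPn => e.
move=> /mapP[[k b] _ ->]; apply/negP => /mapP[[[k' i] []] _] /= [] _ E1 _ E2; move: E1; rewrite -E2; by case: b {E2}.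
Qed.

Definition rate := jump_rate p q d0 l0 d1 l1.

(** A jump with both ends off the box does not change a function of the box; this is what reduces
    the sum over all pairs of sites to the listed edges. *)
Lemma rate_notin_edges c n x y : rate x y != 0 -> (x, y) \notin hedges c n ++ vedges c n ->
  x \notin box c n /\ y \notin box c n.
Proof.
case: x => z i; case: y => z' j + H; rewrite /rate /jump_rate /=; have [E|ij] := eqVneq i j.
  rewrite -{j}E in H *.
  have [E|_] := eqVneq z' (z + 1).
    move=> _; rewrite {z'}E in H *; suff : ~~ ((c <= z < c + n%:Z) || (c <= z + 1 < c + n%:Z)).
      by rewrite !mem_box /= negb_or => /andP[].
    apply: contra H => H.
    rewrite mem_cat; apply/orP; left.
    have -> : (z, i, (z + 1, i)) = hedge c (`|(z + 1 - c)%R|%N, i, true).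
      by rewrite /=; congr (_, _, (_, _)); lia.
    by apply: mem_hedges; lia.
  have [E|_] := eqVneq z' (z - 1); last by rewrite eqxx.
  move=> _; rewrite {z'}E in H *; suff : ~~ ((c <= z < c + n%:Z) || (c <= z - 1 < c + n%:Z)).
    by rewrite !mem_box /= negb_or => /andP[].
  apply: contra H => H.
  rewrite mem_cat; apply/orP; left.
  have -> : (z, i, (z - 1, i)) = hedge c (`|(z - c)%R|%N, i, false).
    by rewrite /=; congr (_, _, (_, _)); lia.
  by apply: mem_hedges; lia.
have [E|_] := eqVneq z' z; last by rewrite eqxx.
move=> _; rewrite {z'}E in H *; suff : ~~ (c <= z < c + n%:Z).
  by rewrite !mem_box /= => ->.
apply: contra H => H.
rewrite mem_cat; apply/orP; right.
have -> : (z, i, (z, j)) = vedge c (`|(z - c)%R|%N, j).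
  by rewrite /=; congr (_, _, (_, _)); try lia; case: i j ij => [] [].
by apply: mem_vedges; lia.
Qed.

Definition gen_term x y f eta : R :=
  rate x y * (eta x)%:R * (1 - (eta y)%:R) * (f (move_particle eta x y) - f eta).

Lemma gen_term_jump x y f eta : x != y -> gen_term x y f eta = rate x y * jump x y f eta.
Proof.
move=> xy; rewrite /gen_term /jump /jp !mulrA.
have [ex|ex] := boolP (eta x); last by rewrite !(mulr0,mul0r).
have [ey|ey] := boolP (eta y); first by rewrite subrr !(mulr0,mul0r).
by rewrite move_particle_sw.
Qed.

Definition hsum c n (F : site -> site -> R) : R :=
  \sum_(k <- iota 0 n.+1) \sum_(i <- [:: false; true])
    (dd i * F (c + k%:Z - 1, i) (c + k%:Z, i) + ll i * F (c + k%:Z, i) (c + k%:Z - 1, i)).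

Definition vsum c n (F : site -> site -> R) : R :=
  \sum_(k <- iota 0 n)
    (p * F (c + k%:Z, false) (c + k%:Z, true) + q * F (c + k%:Z, true) (c + k%:Z, false)).

Lemma pregenerator_box c n f eta : dep (box c n) f ->
  pregenerator p q d0 l0 d1 l1 f eta =
  hsum c n (fun x y => jump x y f eta) + vsum c n (fun x y => jump x y f eta).
Proof.
move=> df; rewrite /pregenerator.
rewrite (fsbigE (hedges c n ++ vedges c n)) //; first last.
- move=> [x y] _ H /=; rewrite -[LHS]/(gen_term x y f eta).
  have [r0|r0] := eqVneq (rate x y) 0; first by rewrite /gen_term r0 !mul0r.
  have [xb yb] := rate_notin_edges r0 H.
  rewrite /gen_term (df _ eta) ?subrr ?mulr0// => z zb; rewrite /move_particle.
  case: eqP => [zy|_]; first by move: yb; rewrite -zy zb.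
  by case: eqP => [zx|//]; move: xb; rewrite -zx zb.
- exact: edges_uniq.
under eq_bigl do rewrite in_setT.
rewrite big_cat /=; congr (_ + _).
  rewrite /hedges big_map !big_allpairs; apply: eq_bigr => k _; apply: eq_bigr => i _.
  transitivity (gen_term (c + k%:Z - 1, i) (c + k%:Z, i) f eta + gen_term (c + k%:Z, i) (c + k%:Z - 1, i) f eta).
    by rewrite !big_cons big_nil /= addr0.
  rewrite !gen_term_jump; last 2 first.
  - by apply/eqP => -[]; lia.
  - by apply/eqP => -[]; lia.
  rewrite /rate /jump_rate /= eqxx subrK eqxx.
  by rewrite (_ : (c + k%:Z - 1 == c + k%:Z + 1) = false) ?eqxx//; apply/eqP; lia.
rewrite /vedges big_map !big_allpairs; apply: eq_bigr => k _.
transitivity (gen_term (c + k%:Z, false) (c + k%:Z, true) f eta + gen_term (c + k%:Z, true) (c + k%:Z, false) f eta).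
  by rewrite !big_cons big_nil /= addr0.
by rewrite !gen_term_jump; [rewrite /rate /jump_rate /= eqxx|apply/eqP => -[]..].
Qed.

Lemma dep_jp x y A : x \in A -> y \in A -> dep A (jp x y).
Proof. by move=> xA yA eta zeta H; rewrite /jp !H. Qed.

Lemma continuous_jp x y : continuous (jp x y).
Proof. by apply: (dep_continuous (A := [:: x; y])); apply: dep_jp; rewrite !inE eqxx ?orbT. Qed.

Lemma dep_sw x y f A : x \in A -> y \in A -> dep A f -> dep A (f \o sw x y).
Proof. by move=> xA yA df eta zeta H; apply: df => z zA; rewrite /sw H// mem_swp. Qed.

Lemma dep_jump x y f A : dep A f -> dep (x :: y :: A) (jump x y f).
Proof.
move=> df eta zeta H; rewrite /jump.
have sA : {subset A <= x :: y :: A} by move=> z zA; rewrite !inE zA !orbT.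
have df' := dep_sub sA df.
have xA : x \in x :: y :: A by rewrite inE eqxx.
have yA : y \in x :: y :: A by rewrite !inE eqxx orbT.
by rewrite (dep_jp xA yA H) (df' _ _ H) -/((f \o sw x y) eta) (dep_sw xA yA df' H).
Qed.

Lemma continuous_jump x y f A : dep A f -> continuous (jump x y f).
Proof. by move=> /(dep_jump (x := x) (y := y)) /dep_continuous. Qed.

Variable mu : probability borel_config R.

Lemma ev_pregenerator_box c n f : dep (box c n) f ->
  ev mu (pregenerator p q d0 l0 d1 l1 f) =
  hsum c n (fun x y => ev mu (jump x y f)) + vsum c n (fun x y => ev mu (jump x y f)).
Proof.
move=> df; have cj x y := continuous_jump (x := x) (y := y) df.
have cm (a : R) x y : continuous (fun eta => a * jump x y f eta) by apply: continuous_scale.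
have -> : pregenerator p q d0 l0 d1 l1 f = (fun eta =>
  hsum c n (fun x y => jump x y f eta) + vsum c n (fun x y => jump x y f eta)).
  by apply/funext => eta; exact: pregenerator_box.
rewrite ev_add; last 2 first.
- apply: continuous_sum => k; apply: continuous_sum => i; exact: continuous_add.
- apply: continuous_sum => k; exact: continuous_add.
rewrite /hsum /vsum !ev_sum; last 2 first.
- move=> k; exact: continuous_add.
- move=> k; apply: continuous_sum => i; exact: continuous_add.
congr (_ + _); apply: eq_bigr => k _.
  rewrite ev_sum; last by move=> i; exact: continuous_add.
  by apply: eq_bigr => i _; rewrite ev_add// !ev_scale.
by rewrite ev_add// !ev_scale.
Qed.

End generator_sum.

(** * Exchangeable balanced measures are stationary *)

Definition lane_preserving (phi : site -> site) := forall x, (phi x).2 = x.2.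

Definition pull (phi : site -> site) (eta : config) : config := fun x => eta (phi x).

Lemma pull_translate k : translate k = pull (fun x => (x.1 + k, x.2)). Proof. by []. Qed.

Lemma swp_lane x y : x.2 = y.2 -> lane_preserving (swp x y).
Proof. by move=> xy z; rewrite /swp; case: eqP => [->//|_]; case: eqP => [->|]. Qed.

Lemma swp_inj x y : injective (swp x y).
Proof. exact: inv_inj (@swpK x y). Qed.

Lemma preimage_pull_scyl phi s : pull phi @^-1` scyl s = scyl [seq (phi e.1, e.2) | e <- s].
Proof.
apply/seteqP; split=> eta /= H e; first by move=> /mapP[e' es ->]; exact: (H e').
by move=> es; apply: (H (phi e.1, e.2)); apply/mapP; exists e.
Qed.

Lemma measurable_scyl s : measurable (scyl s : set borel_config).
Proof. by have [->|[A _ [c ->]]] := scylP s; [exact: measurable0|exact: measurable_cyl]. Qed.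

Lemma measurable_pull phi : measurable_fun setT (pull phi : borel_config -> borel_config).
Proof.
apply: (@measurability _ _ borel_config borel_config setT (pull phi) (range scyl)); first by rewrite sigma_scyl.
move=> _ [_ [s _ <-] <-]; rewrite setTI preimage_pull_scyl; exact: measurable_scyl.
Qed.

Lemma measurable_preimage_pull phi (B : set borel_config) :
  measurable B -> measurable (pull phi @^-1` B : set borel_config).
Proof. by move=> mB; rewrite -[X in measurable X]setTI; exact: measurable_pull. Qed.

Lemma box_sub (A : seq site) : exists c n, {subset A <= box c n}.
Proof.
elim: A => [|x A [c [n IH]]]; first by exists 0, 0%N.
exists (Num.min c x.1), (`|(Num.max (c + n%:Z) (x.1 + 1) - Num.min c x.1)%R|%N).
move=> y; rewrite inE mem_box => /orP[/eqP ->|/IH]; rewrite ?mem_box; lia.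
Qed.

Section exchangeable.
Context {R : realType}.
Implicit Types (f g : config -> R) (mu : probability borel_config R).

(** Injections, not only permutations, are allowed: they include the relabelling that misses one
    site, on which the conditioning argument rests. *)
Definition exchangeable mu := forall phi, injective phi -> lane_preserving phi ->
  forall B : set borel_config, measurable B -> mu (pull phi @^-1` B) = mu B.

Definition balanced (p q : R) mu := forall A c u v, u.2 = false -> v.2 = true ->
  u \in A -> v \in A -> c u = true -> c v = false ->
  p * pr mu A c = q * pr mu A (sw u v c).

Lemma ev_ind mu (B : set borel_config) : measurable B ->
  ev mu (fun eta => (`[< B eta >])%:R) = fine (mu B).
Proof. by move=> mB; rewrite /ev /Rintegral -[in RHS](setIT B) -integral_indic. Qed.

Lemma exchangeable_ev mu phi A f : exchangeable mu -> injective phi -> lane_preserving phi ->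
  uniq A -> dep A f -> ev mu (fun eta => f (pull phi eta)) = ev mu f.
Proof.
move=> ex inj lp uA df.
have dphi (g : config -> R) : dep A g -> dep [seq phi x | x <- A] (fun eta => g (pull phi eta)).
  move=> dg eta zeta H; apply: dg => x xA; exact/H/map_f.
transitivity (ev mu (fun eta => \sum_(c <- cfgs A) f c * indc A c (pull phi eta))).
  by congr ev; apply/funext => eta; exact: dep_sum_indc.
have ci c := dep_continuous (dphi _ (@dep_indc R A c)).
rewrite ev_sum; last by move=> c; exact: continuous_scale.
rewrite (ev_dep mu uA df); apply: eq_bigr => c _; rewrite ev_scale//; congr (_ * _).
rewrite /pr -(ex phi)//; last exact: measurable_cyl.
rewrite -(ev_ind mu)//; apply: measurable_preimage_pull; exact: measurable_cyl.
Qed.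

Lemma exchangeable_sw mu x y A f : exchangeable mu -> x.2 = y.2 -> dep A f ->
  ev mu (fun eta => f (sw x y eta)) = ev mu f.
Proof.
move=> ex xy df; apply: (exchangeable_ev (phi := swp x y) (A := undup A)) => //.
- exact: swp_inj.
- exact: swp_lane.
- exact: undup_uniq.
- by apply: dep_sub df => z; rewrite mem_undup.
Qed.

Lemma exchangeable_translation mu : exchangeable mu -> translation_invariant mu.
Proof.
move=> ex k B mB; rewrite pull_translate; apply: ex => //.
by move=> [z i] [z' i'] /= [] /addIr -> ->.
Qed.

Lemma jp_sw x y eta : jp x y (sw x y eta) = jp y x eta :> R.
Proof. by rewrite /jp /sw swp_l swp_r. Qed.

Lemma continuous_mul f g : continuous f -> continuous g -> continuous (fun eta => f eta * g eta).
Proof. by move=> cf cg eta; apply: cvgM; [exact: cf|exact: cg]. Qed.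

Lemma continuous_site x : continuous (fun eta : config => (eta x)%:R : R).
Proof. by apply: (dep_continuous (A := [:: x])) => eta zeta H; rewrite H ?inE. Qed.

Lemma ev_jump mu x y A f : dep A f ->
  ev mu (jump x y f) = ev mu (fun eta => jp x y eta * f (sw x y eta)) - ev mu (fun eta => jp x y eta * f eta).
Proof.
move=> df; set B := x :: y :: A.
have dB : dep B f by apply: dep_sub df => z zA; rewrite !inE zA !orbT.
have [xB yB] : x \in B /\ y \in B by rewrite !inE !eqxx orbT.
rewrite -ev_sub; first by congr ev; apply/funext => eta; rewrite /jump mulrBr.
- apply: continuous_mul; first exact: continuous_jp.
  exact: dep_continuous (dep_sw xB yB dB).
- by apply: continuous_mul; [exact: continuous_jp|exact: dep_continuous df].
Qed.

Lemma dep_jp_mul x y A f : dep A f -> dep (x :: y :: A) (fun eta => jp x y eta * f eta).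
Proof.
move=> df eta zeta H; have sA : {subset A <= x :: y :: A} by move=> z zA; rewrite !inE zA !orbT.
rewrite (dep_sub sA df H) (@dep_jp R x y (x :: y :: A) _ _ _ _ H)// !inE eqxx ?orbT//.
Qed.

(** Exchanging [x] and [y] turns the gain term into [jp y x * f], and [jp y x - jp x y] is the
    occupation of [y] minus that of [x]. In the mean, the generator along a lane is thus a discrete
    gradient. *)
Lemma exchangeable_ev_jump mu x y A f : exchangeable mu -> x.2 = y.2 -> dep A f ->
  ev mu (jump x y f) = ev mu (fun eta => (eta y)%:R * f eta) - ev mu (fun eta => (eta x)%:R * f eta).
Proof.
move=> ex xy df; rewrite (ev_jump mu x y df).
have -> : ev mu (fun eta => jp x y eta * f (sw x y eta)) = ev mu (fun eta => jp y x eta * f eta).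
  rewrite -(exchangeable_sw ex xy (dep_jp_mul (x := y) (y := x) df)).
  by congr ev; apply/funext => eta; rewrite swC jp_sw.
have cf := dep_continuous df.
rewrite -!ev_sub; try (by apply: continuous_mul => //; exact: continuous_jp);
  try (by apply: continuous_mul => //; exact: continuous_site).
by congr ev; apply/funext => eta; rewrite /jp; ring.
Qed.

Lemma balanced_ev p q mu x y A f : balanced p q mu -> x.2 = false -> y.2 = true -> dep A f ->
  p * ev mu (fun eta => jp x y eta * f eta) = q * ev mu (fun eta => jp y x eta * f (sw x y eta)).
Proof.
move=> bal x2 y2 df; set B := undup (x :: y :: A).
have uB : uniq B by exact: undup_uniq.
have [xB yB] : x \in B /\ y \in B by rewrite !mem_undup !inE !eqxx orbT.
have dB : dep B f by apply: dep_sub df => z zA; rewrite mem_undup !inE zA !orbT.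
have d1 : dep B (fun eta => jp x y eta * f eta).
  by move=> eta zeta H; rewrite (dB _ _ H) (dep_jp xB yB H).
have d2 : dep B (fun eta => jp y x eta * f (sw x y eta)).
  by move=> eta zeta H; rewrite (dep_jp yB xB H); congr (_ * _); exact: (dep_sw xB yB dB H).
rewrite (ev_dep mu uB d1) (ev_dep mu uB d2).
rewrite -[in RHS](sum_cfgs_involution _ uB (sw_local xB yB)) !mulr_sumr.
apply: eq_bigr => c _; rewrite swK [in RHS]swC jp_sw /jp.
have [cx|cx] := boolP (c x); last by rewrite !(mul0r,mulr0).
have [cy|cy] := boolP (c y); first by rewrite subrr !(mul0r,mulr0).
rewrite subr0 !mul1r mulrCA (bal B c x y)//; last exact: negbTE.
by rewrite swC mulrCA.
Qed.

(** Detailed balance cancels each vertical bond. Along a lane the means telescope to the two sites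
    just outside the box, which [f] does not see and which exchangeability identifies. *)
Lemma exchangeable_balanced_generator (p q d0 l0 d1 l1 : R) mu f :
  exchangeable mu -> balanced p q mu -> cylinder_function f ->
  ev mu (pregenerator p q d0 l0 d1 l1 f) = 0.
Proof.
move=> ex bal [A dfA]; have [c [n AB]] := box_sub A.
have df : dep (box c n) f by exact: dep_sub AB dfA.
rewrite (ev_pregenerator_box _ _ _ _ _ _ _ df) /vsum /hsum.
rewrite [X in _ + X]big1 ?addr0; last first.
  move=> k _; set x := (_, false); set y := (_, true).
  set B := x :: y :: box c n.
  have dB : dep B f by apply: dep_sub df => z zA; rewrite !inE zA !orbT.
  have [xB yB] : x \in B /\ y \in B by rewrite !inE !eqxx orbT.
  have E1 := balanced_ev bal (erefl : x.2 = false) (erefl : y.2 = true) df.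
  have E2 := balanced_ev bal (erefl : x.2 = false) (erefl : y.2 = true) (dep_sw xB yB dB).
  rewrite !(ev_jump _ _ _ df) !mulrBr E1 E2.
  have -> : (fun eta => jp y x eta * (f \o sw x y) (sw x y eta)) = (fun eta => jp y x eta * f eta).
    by apply/funext => eta /=; rewrite swK.
  have -> : (fun eta => jp y x eta * f (sw y x eta)) = (fun eta => jp y x eta * f (sw x y eta)).
    by apply/funext => eta /=; rewrite swC.
  ring.
rewrite exchange_big big1 // => i _.
pose m z := ev mu (fun eta => (eta (z, i))%:R * f eta).
(* Written with [k.+1 - 1] so that the summand has the form [F k.+1 - F k], where [F k] belongs to
   column [c + k - 1]. *)
transitivity (\sum_(0 <= k < n.+1) (dd d0 d1 i - ll l0 l1 i) * (m (c + k.+1%:Z - 1) - m (c + k%:Z - 1))).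
  rewrite /index_iota subn0; apply: eq_bigr => k _.
  rewrite !(exchangeable_ev_jump ex _ df)// -/(m _) -/(m _).
  have -> : c + k.+1%:Z - 1 = c + k%:Z by lia.
  ring.
rewrite -mulr_sumr telescope_sumr// [X in _ * X](_ : _ = 0) ?mulr0//.
apply/eqP; rewrite subr_eq0; apply/eqP; rewrite /m.
set x := (_, i); set y := (c + 0 - 1, i).
have xb : x \notin box c n by rewrite mem_box /=; lia.
have yb : y \notin box c n by rewrite mem_box /=; lia.
have dxf : dep (x :: box c n) (fun eta => (eta x)%:R * f eta).
  move=> eta zeta H; rewrite H ?mem_head// (df _ zeta)// => z zb.
  by apply: H; rewrite inE zb orbT.
rewrite -(exchangeable_sw (x := x) (y := y) ex _ dxf)//.
congr ev; apply/funext => eta; congr (_ * _); first by rewrite /sw swp_l.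
apply: df => z zb; rewrite /sw swp_n//.
  by apply: contraNneq xb => <-.
by apply: contraNneq yb => <-.
Qed.

End exchangeable.

(** * Entropy production *)

Section relative_entropy_term.
Context {R : realType}.

Lemma ln_leB1 (u : R) : 0 < u -> ln u <= u - 1.
Proof.
move=> u0; have := @le_ln1Dx R (u - 1).
have -> : 1 + (u - 1) = u by ring.
by apply; lra.
Qed.

Lemma ln_ltB1 (u : R) : 0 < u -> u != 1 -> ln u < u - 1.
Proof.
move=> u0 u1; rewrite ltrBrDl -[X in _ < X](@lnK R u)//.
apply: expR_gt1Dx; apply: contra u1 => /eqP lnu.
by rewrite -(@lnK R u)// lnu expR0.
Qed.

(** The relative-entropy summand for unnormalised masses; the correction [- a + b] makes each
    summand nonnegative for positive masses, and zero only when they agree. *)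
Definition kl (a b : R) : R := a * ln (a / b) - a + b.

Lemma klE (a b : R) : 0 < a -> 0 < b -> kl a b = a * ((b / a) - 1 - ln (b / a)).
Proof.
move=> a0 b0; rewrite /kl -[a / b]invrK invf_div lnV ?posrE ?divr_gt0//.
by field; rewrite gt_eqF.
Qed.

Lemma kl_ge0 (a b : R) : 0 < a -> 0 < b -> 0 <= kl a b.
Proof. by move=> a0 b0; rewrite klE// mulr_ge0 ?(ltW a0)// subr_ge0 ln_leB1// divr_gt0. Qed.

Lemma kl_eq0 (a b : R) : 0 < a -> 0 < b -> kl a b <= 0 -> a = b.
Proof.
move=> a0 b0; have [->//|ab] := eqVneq a b.
rewrite klE// pmulr_rle0// subr_le0 leNgt ln_ltB1//; first exact: divr_gt0.
apply: contra ab => /eqP E; apply/eqP.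
by rewrite -[b](divfK (lt0r_neq0 a0)) E mul1r.
Qed.

End relative_entropy_term.

Definition down_count (A : seq site) (eta : config) : nat := (\sum_(z <- A) (z.2 && eta z))%N.

(** A balance with additions on both sides: it avoids truncated subtraction and treats horizontal
    and vertical exchanges alike. *)
Lemma down_count_sw A x y (eta : config) : uniq A -> x \in A -> y \in A -> x != y ->
  (down_count A (sw x y eta) + (x.2 && eta x) + (y.2 && eta y) =
   down_count A eta + (x.2 && eta y) + (y.2 && eta x))%N.
Proof.
move=> uA xA yA xy; rewrite /down_count.
have split2 (G : site -> nat) : (\sum_(z <- A) G z = G x + (G y + \sum_(z <- A | (z != x) && (z != y)) G z))%N.
  rewrite (bigD1_seq x)//=; congr addn.
  rewrite -big_filter (bigD1_seq y) ?filter_uniq ?mem_filter ?yA ?(eq_sym y) ?xy//=.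
  by rewrite big_filter_cond; congr addn; apply: eq_bigl => z; rewrite andbC.
rewrite !split2 /sw swp_l swp_r.
under eq_bigr => z /andP[zx zy] do rewrite swp_n//.
by case: (x.2 && eta x); case: (x.2 && eta y); case: (y.2 && eta x); case: (y.2 && eta y) => /=; lia.
Qed.

Lemma down_count_flip A x (eta : config) : uniq A -> x \in A ->
  (down_count A (flip x eta) <= (down_count A eta).+1)%N /\
  (down_count A eta <= (down_count A (flip x eta)).+1)%N.
Proof.
move=> uA xA; rewrite /down_count !(bigD1_seq x xA uA)/=.
have -> : (\sum_(z <- A | z != x) (z.2 && flip x eta z) = \sum_(z <- A | z != x) (z.2 && eta z))%N.
  by apply: eq_bigr => z /negbTE zx; rewrite /flip /upd zx.
by case: (_ && _); case: (_ && _) => /=; lia.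
Qed.

Lemma dep_down_count A : forall eta zeta : config, {in A, eta =1 zeta} ->
  down_count A eta = down_count A zeta.
Proof. by move=> eta zeta H; apply: eq_big_seq => z zA; rewrite H. Qed.

Section entropy.
Context {R : realType}.
Variables (a : R) (mu : probability borel_config R).
Hypothesis pos : forall A c, 0 < pr mu A c.
Implicit Types (A B : seq site) (x y : site).

(* log-density on A with respect to the weight [a ^ (particles in lane 1)] *)
Definition logd A (eta : config) : R := ln (pr mu A eta) - (down_count A eta)%:R * ln a.

Lemma dep_logd A : dep A (logd A).
Proof. by move=> eta zeta H; rewrite /logd (dep_pr _ H) (dep_down_count H). Qed.

Definition ratio A (s : config -> config) eta : R := pr mu A (s eta) / pr mu A eta.

Lemma ratio_gt0 A s eta : 0 < ratio A s eta.
Proof. exact: divr_gt0. Qed.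

Lemma dep_ratio A s : local_involution A s -> dep A (ratio A s).
Proof. by move=> [_ sA _] eta zeta H; rewrite /ratio (dep_pr _ (sA _ _ H)) (dep_pr _ H). Qed.

Lemma jp01 x y eta : jp x y eta = (eta x && ~~ eta y)%:R :> R.
Proof. by rewrite /jp; case: (eta x); case: (eta y); rewrite /= ?(subr0,subrr,mulr0,mul1r,mul0r). Qed.

(** A localised log-sum inequality. An allowed jump changes [logd] by [ln (ratio / k)]; the bound
    [ln u <= u - 1] gives the two linear terms, and a sharper tangent on the event [zeta] gains
    [kl]. The gain depends on the fixed set [B] only, so it is the same for every box [A] containing
    [B]. In the uses, [k] is 1 along a lane, [a] from lane 0 to lane 1, and its inverse on the way
    back. *)
Lemma ev_jump_interior A B x y (k : R) (zeta : config) :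
  uniq A -> {subset B <= A} -> x \in B -> y \in B -> 0 < k ->
  (forall eta : config, eta x -> ~~ eta y ->
    (down_count A (sw x y eta))%:R * ln a = (down_count A eta)%:R * ln a + ln k) ->
  zeta x -> ~~ zeta y ->
  ev mu (jump x y (logd A)) <=
    k^-1 * ev mu (jp y x) - ev mu (jp x y) - kl (pr mu B zeta) (pr mu B (sw x y zeta) / k).
Proof.
move=> uA BA xB yB k0 Hk zx zy.
have [xA yA] := (BA _ xB, BA _ yB); have loc := sw_local xA yA.
set al := pr mu B zeta; set be := pr mu B (sw x y zeta) / k.
have be0 : 0 < be by apply: divr_gt0.
have al0 : 0 < al by exact: pos.
(* Given [zeta], the mean of [ratio / k] is [be / al = 1 / t]. The tangent to [ln] at that point,
   [ln u <= t u - 1 - ln t], is the best one on [zeta]. *)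
pose t := al / be; have t0 : 0 < t by exact: divr_gt0.
pose g eta : R := k^-1 * (jp x y eta + (t - 1) * indc B zeta eta).
have dind := dep_sub BA (@dep_indc R B zeta).
have djp := @dep_jp R x y A xA yA.
have dg : dep A g by move=> eta1 eta2 H; rewrite /g (djp _ _ H) (dind _ _ H).
have cind (c : config) : continuous (@indc R B c) := dep_continuous (@dep_indc R B c).
have cjp u v : continuous (@jp R u v) := @continuous_jp R u v.
have ub eta : jump x y (logd A) eta <=
    g eta * ratio A (sw x y) eta - (jp x y eta + ln t * indc B zeta eta).
  rewrite /jump /g jp01; have [/andP[ex ey]|nexy] := boolP (eta x && ~~ eta y); last first.
    rewrite mul0r /indc asboolF ?mulr0 ?add0r ?mulr0 ?mul0r ?subr0//.
    by move=> E; move: nexy; rewrite !E// zx zy.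
  have -> : logd A (sw x y eta) - logd A eta = ln (ratio A (sw x y) eta / k).
    rewrite /logd Hk// !lnM ?posrE ?invr_gt0 ?ratio_gt0// !lnV ?posrE//; ring.
  have r0 := divr_gt0 (ratio_gt0 A (sw x y) eta) k0.
  have [Z|Z] := pselect (cyl B zeta eta).
    rewrite /indc asboolT// !mulr1 mul1r (addrC 1) subrK.
    have := ln_leB1 (mulr_gt0 t0 r0); rewrite [ln (t * _)]lnM ?posrE//.
    rewrite -lerBrDl.
    have -> : t * (ratio A (sw x y) eta / k) - 1 - ln t = k^-1 * t * ratio A (sw x y) eta - (1 + ln t) by ring.
    by [].
  rewrite /indc asboolF// !mulr0 !addr0 mulr1 mul1r.
  by have := ln_leB1 r0; rewrite mulrC.
have dgr : dep A (fun eta => g eta * ratio A (sw x y) eta).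
  by move=> eta1 eta2 H; rewrite (dg _ _ H) (dep_ratio loc H).
have cind2 := continuous_scale (a := ln t) (cind zeta).
have cB := continuous_add (cjp x y) cind2.
have cJ := continuous_jump (x := x) (y := y) (@dep_logd A).
have := ev_le mu cJ (continuous_sub (dep_continuous dgr) cB) ub.
move=> /le_trans; apply.
rewrite ev_sub//; last exact: dep_continuous dgr.
rewrite (change_var uA loc (pos A) dg) ev_add// ev_scale// ev_indc -/al.
have -> : g \o sw x y = (fun eta => k^-1 * (jp y x eta + (t - 1) * indc B (sw x y zeta) eta)).
  apply/funext => eta; rewrite /g /= jp_sw; congr (_ * (_ + _ * _)).
  rewrite /indc; congr (nat_of_bool _)%:R; apply/asbool_equiv_eq; split => E z zB.
    by rewrite /sw -E ?mem_swp// /sw swpK.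
  by rewrite /sw E ?mem_swp// /sw swpK.
have cind3 := continuous_scale (a := t - 1) (cind (sw x y zeta)).
rewrite ev_scale; last exact: continuous_add.
rewrite ev_add// ev_scale// ev_indc.
have -> : pr mu B (sw x y zeta) = be * k by rewrite /be divfK// gt_eqF.
rewrite le_eqVlt; apply/orP; left; apply/eqP; rewrite /kl -/t.
have -> : al = t * be by rewrite /t divfK// gt_eqF.
by field; rewrite gt_eqF.
Qed.

(** Only one end of the bond lies in [A], so on [A] the jump acts as a flip. The ratio of a flip has
    mean 1 and the lane-1 count moves by at most one, whence a bound free of [A]. *)
Lemma ev_jump_boundary A x y : uniq A -> (x \in A) (+) (y \in A) ->
  ev mu (jump x y (logd A)) <= 1 + `|ln a|.
Proof.
move=> uA xyA; pose w := if x \in A then x else y.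
have wA : w \in A by rewrite /w; case: ifP xyA => // ->.
have loc := flip_local wA.
(* The [- 1] of the tangent bound is given up, so that the right-hand side is nonnegative and also
   dominates where no jump is possible. *)
have ub eta : jump x y (logd A) eta <= ratio A (flip w) eta + `|ln a|.
  rewrite /jump jp01; have [/andP[ex ey]|nexy] := boolP (eta x && ~~ eta y); last first.
    by rewrite mul0r addr_ge0// ltW// ratio_gt0.
  rewrite mul1r (dep_logd (_ : {in A, sw x y eta =1 flip w eta})); last first.
    move=> z zA; rewrite /sw /flip /upd /w.
    case: (boolP (x \in A)) xyA => xA /= yA.
      have zy : z != y by apply: contraNneq yA => <-.
      by have [->|zx] := eqVneq z x; [rewrite swp_l ex (negbTE ey)|rewrite swp_n].
    have zx : z != x by apply: contraNneq xA => <-.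
    by have [->|zy] := eqVneq z y; [rewrite swp_r ex (negbTE ey)|rewrite swp_n].
  have [h1 h2] := down_count_flip eta uA wA.
  rewrite /logd.
  have -> : ln (pr mu A (flip w eta)) = ln (ratio A (flip w) eta) + ln (pr mu A eta).
    by rewrite -lnM ?posrE ?ratio_gt0// /ratio divfK// gt_eqF.
  have := ln_leB1 (ratio_gt0 A (flip w) eta).
  have : `|((down_count A eta)%:R - (down_count A (flip w eta))%:R) * ln a| <= `|ln a|.
    rewrite normrM ler_piMl// ler_norml.
    by move: h1 h2; rewrite -!(ler_nat R) -!natr1 => h1 h2; apply/andP; split; lra.
  move=> /(le_trans (ler_norm _)); lra.
have cr := dep_continuous (dep_ratio loc).
apply: (le_trans (ev_le mu (continuous_jump (@dep_logd A)) (continuous_add cr (@continuous_cst R _)) ub)).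
rewrite ev_add//; last exact: continuous_cst.
rewrite ev_cst lerD2r.
have -> : ratio A (flip w) = (fun eta => 1 * (pr mu A (flip w eta) / pr mu A eta)).
  by apply/funext => eta; rewrite mul1r.
by rewrite (change_var (g := fun=> 1) uA loc (pos A))// ev_cst.
Qed.

End entropy.

Definition trs (k : int) (x : site) : site := (x.1 + k, x.2).

(** The shift is by [- k] so that the moved pattern has at [trs k x] the value it had at [x]. *)
Definition trc (k : int) (eta : config) : config := pull (trs (- k)) eta.

Lemma trsK k : cancel (trs k) (trs (- k)).
Proof. by move=> [z i]; rewrite /trs /= addrK. Qed.

Lemma trsNK k : cancel (trs (- k)) (trs k).
Proof. by move=> [z i]; rewrite /trs /= subrK. Qed.

Lemma sw_translate k x y (zeta : config) :
  sw (trs k x) (trs k y) (trc k zeta) = trc k (sw x y zeta).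
Proof.
apply/funext => z; rewrite /sw /trc /pull /swp.
rewrite !(can2_eq (trsNK k) (trsK k)).
by case: ifP => _; [rewrite trsK|case: ifP => _; rewrite ?trsK].
Qed.

Lemma archimedean_le0 (R : realType) (C e : R) : (forall n, n%:R * e <= C) -> e <= 0.
Proof.
move=> H; rewrite leNgt; apply/negP => e0.
have C0 : 0 <= C by have := H 0%N; rewrite mul0r.
have := H (Num.bound (C / e)); apply/negP; rewrite -ltNge -ltr_pdivrMr//.
by apply: archi_boundP; rewrite divr_ge0// ltW.
Qed.

Lemma sum_iota_bound (R : realType) (T : nat -> R) (s N n : nat) (e : R) :
  (forall k, (k < N)%N -> T k <= 0) ->
  (forall k, (s <= k <= s + n)%N -> T k <= - e) ->
  (s + n < N)%N -> \sum_(k <- iota 0 N) T k <= - (n.+1%:R * e).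
Proof.
move=> H1 H2 snN; have -> : iota 0 N = index_iota 0 N by rewrite /index_iota subn0.
rewrite (@big_cat_nat _ _ _ s)//=; last by lia.
rewrite (@big_cat_nat _ _ _ (s + n).+1 s)//=; last by lia.
have h1 : \sum_(0 <= k < s) T k <= 0.
  by rewrite big_nat; apply: sumr_le0 => k kN; apply: H1; lia.
have h2 : \sum_(s <= k < (s + n).+1) T k <= - (n.+1%:R * e).
  rewrite big_nat; apply: le_trans (_ : \sum_(s <= k < (s + n).+1 | (s <= k < (s + n).+1)%N) - e <= _).
    by apply: ler_sum => k kN; apply: H2; lia.
  by rewrite -big_nat sumr_const_nat -addnS addKn mulNrn mulr_natl.
have h3 : \sum_((s + n).+1 <= k < N) T k <= 0.
  by rewrite big_nat; apply: sumr_le0 => k kN; apply: H1; lia.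
lra.
Qed.

Section entropy_balance.
Context {R : realType}.
Variables (p q d0 l0 d1 l1 a : R) (mu : probability borel_config R).
Hypotheses (p0 : 0 <= p) (q0 : 0 <= q) (d00 : 0 <= d0) (l00 : 0 <= l0) (d10 : 0 <= d1) (l10 : 0 <= l1).
Hypotheses (a0 : 0 < a) (pqa : p = q * a).
Hypothesis pos : forall A c, 0 < pr mu A c.
Hypothesis tinv : translation_invariant mu.
Hypothesis gen0 : forall f, cylinder_function f -> ev mu (pregenerator p q d0 l0 d1 l1 f) = 0.
Implicit Types (A B : seq site) (x y : site) (zeta : config).

Let dl := dd d0 d1.
Let lr := ll l0 l1.

Lemma dl_ge0 i : 0 <= dl i. Proof. by rewrite /dl /dd; case: i. Qed.
Lemma lr_ge0 i : 0 <= lr i. Proof. by rewrite /lr /ll; case: i. Qed.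

Lemma pr_translate k B zeta : pr mu [seq trs k x | x <- B] (trc k zeta) = pr mu B zeta.
Proof.
rewrite /pr; congr fine; rewrite -(tinv k (measurable_cyl B zeta)); congr (mu _).
rewrite pull_translate; apply/seteqP; split=> eta /= H x.
  move=> xB; rewrite -/(trs k) [LHS]/pull -/(trs k x) H ?map_f//.
  by rewrite /trc /pull trsK.
move=> /mapP[y yB ->]; rewrite /trc /pull trsK; exact: H.
Qed.

Lemma ev_site_lane x y : x.2 = y.2 -> ev mu (fun eta => (eta x)%:R) = ev mu (fun eta => (eta y)%:R).
Proof.
have E z : ev mu (fun eta => (eta z)%:R) = pr mu [:: z] (fun=> true).
  rewrite -ev_indc; congr ev; apply/funext => eta; rewrite /indc; congr (nat_of_bool _)%:R.
  by apply/esym/asbool_equiv_eqP; [exact: idP|rewrite cyl1].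
move=> xy; rewrite !E -(pr_translate (y.1 - x.1) [:: x]) /=.
congr (pr mu [:: _] _); rewrite /trs xy addrC subrK; by case: y xy.
Qed.

(** The two indicators differ by the occupation of [x] minus that of [y], of mean 0 by translation
    invariance. This cancels the linear terms of [ev_jump_interior] for each horizontal direction
    separately, whatever the drift. *)
Lemma ev_jp_lane x y : x.2 = y.2 -> ev mu (jp x y) = ev mu (jp y x).
Proof.
move=> xy; apply/eqP; rewrite -subr_eq0 -ev_sub; [|exact: continuous_jp..].
have -> : (fun eta : config => jp x y eta - jp y x eta) = (fun eta : config => (eta x)%:R - (eta y)%:R :> R).
  by apply/funext => eta; rewrite /jp; ring.
rewrite ev_sub; [|exact: continuous_site..].
by rewrite (ev_site_lane xy) subrr.
Qed.

Lemma ev_jump_horizontal A B x y zeta : uniq A -> {subset B <= A} -> x \in B -> y \in B ->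
  x.2 = y.2 -> zeta x -> ~~ zeta y ->
  ev mu (jump x y (logd a mu A)) <= - kl (pr mu B zeta) (pr mu B (sw x y zeta)).
Proof.
move=> uA BA xB yB xy zx zy.
have xNy : x != y by apply: contraTneq zx => ->.
have := ev_jump_interior (a := a) pos uA BA xB yB (ltr01 : 0 < 1 :> R) _ zx zy.
rewrite invr1 mul1r mulr1 (ev_jp_lane xy) subrr sub0r; apply.
move=> eta ex ey; rewrite ln1 addr0.
have := down_count_sw eta uA (BA _ xB) (BA _ yB) xNy.
rewrite xy ex (negbTE ey) andbT andbF => E.
have -> : down_count A (sw x y eta) = down_count A eta by clear -E; lia.
by [].
Qed.

Lemma ev_jump_horizontal_le0 A x y : uniq A -> x \in A -> y \in A -> x.2 = y.2 -> x != y ->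
  ev mu (jump x y (logd a mu A)) <= 0.
Proof.
move=> uA xA yA xy xNy.
(* Some pattern with [x] occupied and [y] empty has to be supplied; only the sign of its [kl]
   matters here. *)
have := @ev_jump_horizontal A A x y (upd (fun=> false) x true) uA (fun _ h => h) xA yA xy.
rewrite /upd eqxx eq_sym (negbTE xNy) => /(_ isT isT) /le_trans; apply.
by rewrite oppr_le0 kl_ge0.
Qed.

(** Weighted by [p] and [q = p / a], the linear terms of the two directions cancel. The entropy gain
    is kept for the jump to lane 1; that of the reverse jump enters only through its sign. *)
Lemma ev_jump_vertical A B x y zeta : uniq A -> {subset B <= A} -> x \in B -> y \in B ->
  x.2 = false -> y.2 = true -> zeta x -> ~~ zeta y ->
  p * ev mu (jump x y (logd a mu A)) + q * ev mu (jump y x (logd a mu A)) <=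
  - (p * kl (pr mu B zeta) (pr mu B (sw x y zeta) / a)).
Proof.
move=> uA BA xB yB x2 y2 zx zy.
have xNy : x != y by apply: contraTneq zx => ->.
have h1 := ev_jump_interior (a := a) pos uA BA xB yB a0 _ zx zy.
have h2 := @ev_jump_interior _ a mu pos A A y x (a^-1) (sw x y zeta) uA (fun _ h => h) (BA _ yB) (BA _ xB) _ _ _ _.
have {}h1 : ev mu (jump x y (logd a mu A)) <= a^-1 * ev mu (jp y x) - ev mu (jp x y) - kl (pr mu B zeta) (pr mu B (sw x y zeta) / a).
  apply: h1 => eta ex ey; have := down_count_sw eta uA (BA _ xB) (BA _ yB) xNy.
  rewrite x2 y2 ex (negbTE ey) /= => E.
  have -> : down_count A (sw x y eta) = (down_count A eta).+1 by clear -E; lia.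
  by rewrite -natr1 mulrDl mul1r.
have {}h2 : ev mu (jump y x (logd a mu A)) <= a * ev mu (jp x y) - ev mu (jp y x).
  have {}h2 := h2 (_ : 0 < a^-1); rewrite invrK in h2.
  apply: le_trans (h2 _ _ _ _) _.
  - by rewrite invr_gt0.
  - move=> eta ey ex; have := down_count_sw eta uA (BA _ yB) (BA _ xB) (_ : y != x).
    rewrite eq_sym xNy x2 y2 ey (negbTE ex) /= => /(_ isT) E.
    have -> : down_count A eta = (down_count A (sw y x eta)).+1 by clear -E; lia.
    by rewrite lnV ?posrE// -addn1 natrD mulrDl mul1r addrK.
  - by rewrite /sw swp_r.
  - by rewrite /sw swp_l.
  - by rewrite lerBlDr lerDl kl_ge0// mulr_gt0.
have := ler_wpM2l p0 h1; have := ler_wpM2l q0 h2.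
rewrite !mulrBr; have -> : p * (a^-1 * ev mu (jp y x)) = q * ev mu (jp y x).
  by rewrite mulrA pqa mulfK// gt_eqF.
have -> : q * (a * ev mu (jp x y)) = p * ev mu (jp x y) by rewrite mulrA -pqa.
lra.
Qed.

Lemma ev_jump_vertical_le0 A x y : uniq A -> x \in A -> y \in A -> x.2 = false -> y.2 = true ->
  p * ev mu (jump x y (logd a mu A)) + q * ev mu (jump y x (logd a mu A)) <= 0.
Proof.
move=> uA xA yA x2 y2; have xNy : x != y by apply/eqP => xy; move: x2; rewrite xy y2.
have := @ev_jump_vertical A A x y (upd (fun=> false) x true) uA (fun _ h => h) xA yA x2 y2.
rewrite /upd eqxx eq_sym (negbTE xNy) => /(_ isT isT) /le_trans; apply.
by rewrite oppr_le0 mulr_ge0// kl_ge0// divr_gt0.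
Qed.

Let J A x y := ev mu (jump x y (logd a mu A)).

Let hterm c N k := \sum_(i <- [:: false; true])
    (dl i * J (box c N) (c + k%:Z - 1, i) (c + k%:Z, i) + lr i * J (box c N) (c + k%:Z, i) (c + k%:Z - 1, i)).

Let vterm c N k := p * J (box c N) (c + k%:Z, false) (c + k%:Z, true) +
  q * J (box c N) (c + k%:Z, true) (c + k%:Z, false).

Let bdry := \sum_(i <- [:: false; true]) (dl i + lr i) * (1 + `|ln a|).

Lemma hterm_interior c N k i : (0 < k < N)%N ->
  dl i * J (box c N) (c + k%:Z - 1, i) (c + k%:Z, i) <= 0 /\
  lr i * J (box c N) (c + k%:Z, i) (c + k%:Z - 1, i) <= 0.
Proof.
move=> kN; split; (apply: mulr_ge0_le0; [exact: dl_ge0 || exact: lr_ge0|]);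
  apply: ev_jump_horizontal_le0; rewrite ?box_uniq ?mem_box//=; try (by clear -kN; lia).
  by apply/eqP => -[]; clear; lia.
by apply/eqP => -[]; clear; lia.
Qed.

Lemma hterm_le0 c N k : (0 < k < N)%N -> hterm c N k <= 0.
Proof.
move=> kN; apply: sumr_le0 => i _.
by have [? ?] := hterm_interior c i kN; rewrite -oppr_ge0 opprD addr_ge0// oppr_ge0.
Qed.

Lemma hterm_bdry c N k : (0 < N)%N -> (k == 0%N) || (k == N) -> hterm c N k <= bdry.
Proof.
move=> N0 kN; apply: ler_sum => i _; rewrite mulrDl.
apply: lerD; (apply: ler_wpM2l; [exact: dl_ge0 || exact: lr_ge0|]);
  (apply: ev_jump_boundary => //; [exact: box_uniq|]); rewrite !mem_box /=;
  by clear -N0 kN; case/orP: kN => /eqP ->; lia.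
Qed.

(** Stationarity tested on [logd] of the box, the two end bonds being replaced by their upper bound.
    Since [bdry] does not involve [N], the total entropy loss inside the box stays bounded as the
    box grows. *)
Lemma entropy_balance c N : (0 < N)%N ->
  0 <= bdry + \sum_(k <- iota 0 N.-1) hterm c N k.+1 + bdry + \sum_(k <- iota 0 N) vterm c N k.
Proof.
move=> N0; have E : ev mu (pregenerator p q d0 l0 d1 l1 (logd a mu (box c N))) = 0.
  by apply: gen0; exists (box c N); exact: dep_logd.
rewrite (ev_pregenerator_box _ _ _ _ _ _ _ (@dep_logd _ a mu (box c N))) in E.
rewrite -[X in X <= _]E.
apply: lerD; last exact: lexx.
have -> : hsum d0 l0 d1 l1 c N (fun x y => ev mu (jump x y (logd a mu (box c N)))) =
  \sum_(k <- iota 0 N.+1) hterm c N k by [].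
have -> : iota 0 N.+1 = 0%N :: [seq k.+1 | k <- iota 0 N.-1] ++ [:: N].
  case: N N0 {E} => // M _; rewrite -[iota 0 M.+2]/(0%N :: iota 1 M.+1) -pred_Sn.
  have -> : iota 1 M.+1 = iota 1 M ++ [:: M.+1] by rewrite -(addn1 M) iotaD add1n addn1.
  by rewrite (iotaDl 1 0).
rewrite big_cons big_cat big_seq1 big_map /=.
have := hterm_bdry c N0 (_ : (0 == 0)%N || (0 == N)%N); rewrite eqxx => /(_ isT).
have := hterm_bdry c N0 (_ : (N == 0)%N || (N == N)%N); rewrite eqxx orbT => /(_ isT).
move: (hterm c N 0) (hterm c N N) (\sum_(_ <- _) _) bdry => X Y Z W; lra.
Qed.

Definition oedge (z : int) (i fwd : bool) : site * site :=
  if fwd then ((z - 1, i), (z, i)) else ((z, i), (z - 1, i)).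

Lemma kl_translate j B x y zeta :
  kl (pr mu [seq trs j z | z <- B] (trc j zeta))
     (pr mu [seq trs j z | z <- B] (sw (trs j x) (trs j y) (trc j zeta))) =
  kl (pr mu B zeta) (pr mu B (sw x y zeta)).
Proof. by rewrite sw_translate !pr_translate. Qed.

Lemma trs_box c m j B N : {subset B <= box c m} -> 0 <= j -> j + m%:Z <= N%:Z ->
  {subset [seq trs j z | z <- B] <= box c N}.
Proof.
move=> Bm j0 jN _ /mapP[x /Bm + ->]; rewrite !mem_box /trs /=.
by clear -j0 jN; lia.
Qed.

Lemma trc_trs j zeta x : trc j zeta (trs j x) = zeta x.
Proof. by rewrite /trc /pull trsK. Qed.

(* Each of the n+1 translates of a non-exchangeable bond consumes the same
   amount of entropy, while only a bounded amount enters through the ends of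
   the box. *)
Lemma horizontal_exchange B z i fwd zeta :
  let e := oedge z i fwd in
  0 < (if fwd then dl i else lr i) -> e.1 \in B -> e.2 \in B -> zeta e.1 -> ~~ zeta e.2 ->
  pr mu B zeta = pr mu B (sw e.1 e.2 zeta).
Proof.
move=> e r0 e1B e2B z1 z2; apply: kl_eq0 => //.
set D := kl _ _; set r := (if fwd then _ else _) in r0.
rewrite -(pmulr_rle0 _ r0); apply: (@archimedean_le0 _ (bdry + bdry + r * D)) => n.
have [c [m Bm]] := box_sub B.
have zc : c < z < c + m%:Z.
  move: (Bm _ e1B) (Bm _ e2B); rewrite !mem_box /e /oedge; clear.
  by case: fwd => /=; lia.
(* [N] columns leave room for the translates of [B] by 0, ..., [n]; [s] is the index of the given
   bond, so its translate by [j] is bond [s + j]. *)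
pose s := `|(z - c)%R|%N; pose N := (m + n)%N.
have [N0 s0 snN] : [/\ (0 < N)%N, (0 < s)%N & (s.-1 + n < N.-1)%N].
  by rewrite /N /s; clear -zc; split; lia.
have D0 : 0 <= D by exact: kl_ge0.
have hs : \sum_(k <- iota 0 N.-1) hterm c N k.+1 <= - (n.+1%:R * (r * D)).
  (* The interior sum runs over bonds [k.+1], hence the start at [s.-1]. *)
  apply: (@sum_iota_bound _ _ s.-1) => // k kn.
    by apply: hterm_le0; clear -kn; lia.
  pose j := k.+1%:Z - s%:Z.
  have j0 : 0 <= j by rewrite /j; clear -kn s0; lia.
  have jN : j + m%:Z <= N%:Z by rewrite /j /N; clear -kn s0; lia.
  have BN := trs_box Bm j0 jN.
  have kN : (0 < k.+1 < N)%N by clear -kn snN; lia.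
  have eD : ev mu (jump (trs j e.1) (trs j e.2) (logd a mu (box c N))) <= - D.
    rewrite /D -(kl_translate j).
    apply: ev_jump_horizontal; rewrite ?trc_trs ?map_f ?box_uniq//.
    by rewrite /e /oedge; case: (fwd).
  have zj b : trs j (z, b) = (c + k.+1%:Z, b).
    by rewrite /trs /=; congr pair; rewrite /j /s; clear -zc; lia.
  have zj1 b : trs j (z - 1, b) = (c + k.+1%:Z - 1, b).
    by rewrite /trs /=; congr pair; rewrite /j /s; clear -zc; lia.
  have other i' := hterm_interior c i' kN.
  have le_r : (if fwd then dl i * J (box c N) (c + k.+1%:Z - 1, i) (c + k.+1%:Z, i)
      else lr i * J (box c N) (c + k.+1%:Z, i) (c + k.+1%:Z - 1, i)) <= - (r * D).
    have r0' : 0 < (if fwd then dl i else lr i) := r0.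
    have e1E : trs j e.1 = if fwd then (c + k.+1%:Z - 1, i) else (c + k.+1%:Z, i).
      by rewrite /e /oedge; case: (fwd); [exact: zj1|exact: zj].
    have e2E : trs j e.2 = if fwd then (c + k.+1%:Z, i) else (c + k.+1%:Z - 1, i).
      by rewrite /e /oedge; case: (fwd); [exact: zj|exact: zj1].
    move: eD r0'; rewrite e1E e2E -mulrN /r /J.
    by case: (fwd) => eD r0'; rewrite ler_pM2l.
  rewrite /hterm !big_cons big_nil.
  by move: (other false) (other true) le_r => [? ?] [? ?]; case: (i); case: (fwd) => ?; lra.
have vs : \sum_(k <- iota 0 N) vterm c N k <= 0.
  rewrite big_seq; apply: sumr_le0 => k; rewrite mem_iota => kN.
  by apply: ev_jump_vertical_le0; rewrite ?box_uniq ?mem_box//=; clear -kN; lia.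
have := entropy_balance c N0; move: hs vs.
rewrite -natr1; have : 0 <= r * D by rewrite mulr_ge0// ltW.
move: (r * D) (\sum_(k <- iota 0 N.-1) _) (\sum_(k <- iota 0 N) _) bdry => X Y Z W.
nra.
Qed.

(** Translates are counted as along a lane, but each column of the box carries a whole vertical
    bond, so there is no shift by one. Equality in [kl] reads as detailed balance with factor
    [a]. *)
Lemma vertical_exchange B z zeta : 0 < p ->
  (z, false) \in B -> (z, true) \in B -> zeta (z, false) -> ~~ zeta (z, true) ->
  pr mu B zeta = pr mu B (sw (z, false) (z, true) zeta) / a.
Proof.
move=> pp e1B e2B z1 z2; apply: kl_eq0 => //; first exact: divr_gt0.
set D := kl _ _.
rewrite -(pmulr_rle0 _ pp); apply: (@archimedean_le0 _ (bdry + bdry + p * D)) => n.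
have [c [m Bm]] := box_sub B.
have zc : c <= z < c + m%:Z by have := Bm _ e1B; rewrite mem_box.
pose s := `|(z - c)%R|%N; pose N := (m + n)%N.
have [N0 snN] : (0 < N)%N /\ (s + n < N)%N by rewrite /N /s; clear -zc; split; lia.
have D0 : 0 <= D by apply: kl_ge0 => //; exact: divr_gt0.
have hs : \sum_(k <- iota 0 N.-1) hterm c N k.+1 <= 0.
  rewrite big_seq; apply: sumr_le0 => k; rewrite mem_iota => kN; apply: hterm_le0.
  by clear -kN; lia.
have vs : \sum_(k <- iota 0 N) vterm c N k <= - (n.+1%:R * (p * D)).
  apply: (@sum_iota_bound _ _ s) => // k kn.
    by apply: ev_jump_vertical_le0; rewrite ?box_uniq ?mem_box//=; clear -kn; lia.
  pose j := k%:Z - s%:Z.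
  have j0 : 0 <= j by rewrite /j; clear -kn; lia.
  have jN : j + m%:Z <= N%:Z by rewrite /j /N; clear -kn; lia.
  have BN := trs_box Bm j0 jN.
  have zj b : trs j (z, b) = (c + k%:Z, b).
    by rewrite /trs /=; congr pair; rewrite /j /s; clear -zc; lia.
  have := @ev_jump_vertical (box c N) [seq trs j z | z <- B] (trs j (z, false)) (trs j (z, true)) (trc j zeta).
  rewrite sw_translate !pr_translate !trc_trs !map_f// box_uniq.
  by rewrite !zj; apply.
have := entropy_balance c N0; move: hs vs.
rewrite -natr1; have : 0 <= p * D by rewrite mulr_ge0// ltW.
move: (p * D) (\sum_(k <- iota 0 N.-1) _) (\sum_(k <- iota 0 N) _) bdry => X Y Z W.
nra.
Qed.

End entropy_balance.

(** * Product measures *)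

Section coin_tosses.
Context {R : realType}.
Variable r : nat -> R.
Hypothesis r01 : forall k, 0 <= r k <= 1.
Implicit Types (u : R) (b : nat -> bool).

Definition split_step (k : nat) (b : bool) (s : R * R) : R * R :=
  if b then (s.1, s.2 * r k) else (s.1 + s.2 * r k, s.2 * (1 - r k)).

(* The interval [s.1, s.1 + s.2[ is cut in proportions r k and 1 - r k; the
   k-th digit of u tells whether u is in the left part. *)
Fixpoint cell u (k : nat) : R * R :=
  if k is k'.+1 then
    let s := cell u k' in split_step k' (u < s.1 + s.2 * r k') s
  else (0, 1).

Definition digit u k : bool := u < (cell u k).1 + (cell u k).2 * r k.

(** The interval of points of [[0, 1[] whose first [k] digits are those of [b], whereas [cell]
    follows a given point. *)
Fixpoint word_cell b (k : nat) : R * R :=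
  if k is k'.+1 then split_step k' (b k') (word_cell b k') else (0, 1).

Lemma word_cell_ge0 b k : 0 <= (word_cell b k).2.
Proof.
elim: k => [|k IH] /=; first exact: ler01.
have /andP[h1 h2] := r01 k.
by rewrite /split_step; case: (b k) => /=; rewrite mulr_ge0// subr_ge0.
Qed.

(** The two parts need a joint induction: digit [n] of [u] is read off from [cell u n], which must
    be known to be the interval prescribed by [b]. *)
Lemma digits_cell u b n : 0 <= u < 1 ->
  ((word_cell b n).1 <= u < (word_cell b n).1 + (word_cell b n).2 <-> forall k, (k < n)%N -> digit u k = b k) /\
  ((forall k, (k < n)%N -> digit u k = b k) -> cell u n = word_cell b n).
Proof.
move=> u01; elim: n => [|n [IH1 IH2]] /=.
  by split => //; split => // _; rewrite add0r.
have c0 := word_cell_ge0 b n; have /andP[rn0 rn1] := r01 n.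
have h1 := mulr_ge0 c0 rn0.
have h2 : 0 <= (word_cell b n).2 * (1 - r n) by rewrite mulr_ge0// subr_ge0.
have E : (word_cell b n).2 * (1 - r n) = (word_cell b n).2 - (word_cell b n).2 * r n by ring.
have sub : (forall k, (k < n.+1)%N -> digit u k = b k) ->
    (forall k, (k < n)%N -> digit u k = b k) /\ digit u n = b n.
  by move=> H; split=> [k kn|]; apply: H => //; exact: ltnW.
split.
- split.
  + move=> H; have Hn : (word_cell b n).1 <= u < (word_cell b n).1 + (word_cell b n).2.
      by move: H; rewrite /split_step; case: (b n) => /= /andP[? ?]; apply/andP; split; lra.
    have Hd := (proj1 IH1) Hn.
    move=> k; rewrite ltnS leq_eqVlt => /predU1P[->|]; last exact: Hd.
    rewrite /digit IH2//; move: H; rewrite /split_step; case: (b n) => /= /andP[h3 h4] //.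
    by apply/negbTE; rewrite -leNgt.
  + move=> /sub[Hd dn]; have /andP[h3 h4] := (proj2 IH1) Hd.
    move: dn; rewrite /digit IH2// /split_step; case: (b n) => /= dn; first by rewrite h3 dn.
    by move/negbT: dn; rewrite -leNgt => ->; apply/andP; split => //; lra.
- by move=> /sub[Hd dn]; rewrite -/(digit u n) dn IH2.
Qed.

Lemma word_cell_length b n : (word_cell b n).2 = \prod_(k <- iota 0 n) bernoulli_pmf (r k) (b k).
Proof.
elim: n => [|n IH]; first by rewrite big_nil.
rewrite -(addn1 n) iotaD big_cat big_seq1 add0n addn1 /= -IH /split_step /bernoulli_pmf.
by case: (b n).
Qed.

Lemma measurable_cell k :
  measurable_fun setT (fun u => (cell u k).1) /\ measurable_fun setT (fun u => (cell u k).2).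
Proof.
elim: k => [|k [IH1 IH2]] /=; first by split; exact: measurable_cst.
have mr : measurable_fun setT (fun u => (cell u k).2 * r k) by apply: measurable_funM.
have ms : measurable_fun setT (fun u => (cell u k).1 + (cell u k).2 * r k) by apply: measurable_funD.
have mb : measurable_fun setT (fun u => u < (cell u k).1 + (cell u k).2 * r k).
  by apply: measurable_fun_ltr.
split.
- rewrite (_ : (fun u => _) = (fun u => if u < (cell u k).1 + (cell u k).2 * r k
    then (cell u k).1 else (cell u k).1 + (cell u k).2 * r k)).
    exact: measurable_fun_ifT.
  by apply/funext => u; rewrite /split_step; case: ifP.
- rewrite (_ : (fun u => _) = (fun u => if u < (cell u k).1 + (cell u k).2 * r k
    then (cell u k).2 * r k else (cell u k).2 * (1 - r k))).
    by apply: measurable_fun_ifT => //; apply: measurable_funM.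
  by apply/funext => u; rewrite /split_step; case: ifP.
Qed.

Lemma measurable_digit k (v : bool) : measurable [set u | digit u k = v].
Proof.
have [m1 m2] := measurable_cell k.
have mb : measurable_fun setT (fun u => digit u k).
  apply: measurable_fun_ltr => //; apply: measurable_funD => //; exact: measurable_funM.
by rewrite -[X in measurable X]setTI; apply: (mb measurableT [set v]).
Qed.

Definition digit_set (I : seq nat) b : set R :=
  `[0, 1[ `&` [set u | {in I, digit u =1 b}].

Lemma digit_set_cons i I b : digit_set (i :: I) b = digit_set I b `&` [set u | digit u i = b i].
Proof.
apply/seteqP; split => u /= [].
  move=> u01 H; split; last by apply: H; rewrite mem_head.
  by split => // k kI; apply: H; rewrite inE kI orbT.
by move=> [u01 H] ui; split => // k; rewrite inE => /predU1P[->|/H].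
Qed.

Lemma measurable_digit_set I b : measurable (digit_set I b).
Proof.
elim: I => [|i I IH]; last by rewrite digit_set_cons; apply: measurableI => //; exact: measurable_digit.
rewrite /digit_set; have -> : [set u | {in [::], digit u =1 b}] = setT by apply/seteqP; split.
by rewrite setIT; exact: measurable_itv.
Qed.


Lemma lebesgue_digit_set_iota n b :
  lebesgue_measure (digit_set (iota 0 n) b) = (\prod_(k <- iota 0 n) bernoulli_pmf (r k) (b k))%:E.
Proof.
rewrite -word_cell_length.
have -> : digit_set (iota 0 n) b = `[(word_cell b n).1, (word_cell b n).1 + (word_cell b n).2[%classic.
  have bound : 0 <= (word_cell b n).1 /\ (word_cell b n).1 + (word_cell b n).2 <= 1.
    elim: n => [|n [IH1 IH2]] /=; first by rewrite add0r.
    have c0 := word_cell_ge0 b n; have /andP[rn0 rn1] := r01 n.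
    have h1 := mulr_ge0 c0 rn0.
    have h2 : 0 <= (word_cell b n).2 * (1 - r n) by rewrite mulr_ge0// subr_ge0.
    have E : (word_cell b n).2 * (1 - r n) = (word_cell b n).2 - (word_cell b n).2 * r n by ring.
    by rewrite /split_step; case: (b n) => /=; split; lra.
  apply/seteqP; split => u; rewrite /digit_set /= !in_itv /=.
    move=> [u01 H]; apply: (proj2 (digits_cell b n u01).1) => k kn.
    by apply: H; rewrite mem_iota.
  move=> H; have u01 : 0 <= u < 1 by case/andP: H => ? ?; apply/andP; split; lra.
  split => // k; rewrite mem_iota add0n => /andP[_ kn].
  exact: (proj1 (digits_cell b n u01).1).
rewrite lebesgue_measure_itv /= lte_fin ltrDl -EFinD.
have := word_cell_ge0 b n; rewrite le_eqVlt => /predU1P[<-|h]; first by rewrite ltxx.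
by rewrite h; congr (_%:E); ring.
Qed.

(** The two weights of digit [i] sum to 1, so adding over its values marginalises it. Repeated, this
    passes from initial segments of digits to arbitrary finite sets. *)
Lemma lebesgue_digit_set_drop i I : i \notin I ->
  (forall b, lebesgue_measure (digit_set (i :: I) b) = (\prod_(k <- i :: I) bernoulli_pmf (r k) (b k))%:E) ->
  forall b, lebesgue_measure (digit_set I b) = (\prod_(k <- I) bernoulli_pmf (r k) (b k))%:E.
Proof.
move=> iI H b.
pose ub v := fun k => if k == i then v else b k.
have ubI v : {in I, ub v =1 b}.
  by move=> k kI; rewrite /ub; case: eqP => // ki; move: iI; rewrite -ki kI.
have Eub v : digit_set (i :: I) (ub v) = digit_set I b `&` [set u | digit u i = v].
  rewrite digit_set_cons /ub eqxx -/(ub v); congr (_ `&` _); congr (_ `&` _).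
  by apply/seteqP; split => u /= h k kI; rewrite h// ubI.
have P v : \prod_(k <- i :: I) bernoulli_pmf (r k) (ub v k) =
    bernoulli_pmf (r i) v * \prod_(k <- I) bernoulli_pmf (r k) (b k).
  rewrite big_cons /ub eqxx; congr (_ * _); apply: eq_big_seq => k kI.
  by rewrite -/(ub v k) ubI.
have -> : digit_set I b = digit_set (i :: I) (ub true) `|` digit_set (i :: I) (ub false).
  rewrite !Eub -setIUr (_ : _ `|` _ = setT) ?setIT//.
  by apply/seteqP; split => // u _ /=; case: (digit u i); [left|right].
transitivity (lebesgue_measure (digit_set (i :: I) (ub true)) +
              lebesgue_measure (digit_set (i :: I) (ub false)))%E.
  apply: measureU; [exact: measurable_digit_set..|].
  by rewrite !Eub; apply/seteqP; split => // u /= [[_ ->]] [].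
by rewrite !H !P -EFinD; congr (_%:E); rewrite /bernoulli_pmf; ring.
Qed.

Lemma lebesgue_digit_set I b : uniq I ->
  lebesgue_measure (digit_set I b) = (\prod_(k <- I) bernoulli_pmf (r k) (b k))%:E.
Proof.
move=> uI; have [n In] : exists n, {subset I <= iota 0 n}.
  exists (\max_(k <- I) k).+1 => k kI; rewrite mem_iota add0n /= ltnS.
  by rewrite (big_rem k)//= leq_maxl.
pose K := [seq k <- iota 0 n | k \notin I].
have perm : perm_eq (K ++ I) (iota 0 n).
  apply: uniq_perm; rewrite ?iota_uniq// ?cat_uniq ?uI ?filter_uniq ?iota_uniq//=.
    by rewrite andbT; apply/hasPn => k kI; rewrite mem_filter kI.
  move=> k; rewrite mem_cat mem_filter; have [/In ->|] := boolP (k \in I); first by rewrite orbT.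
  by rewrite orbF.
have HK : forall b, lebesgue_measure (digit_set (K ++ I) b) = (\prod_(k <- K ++ I) bernoulli_pmf (r k) (b k))%:E.
  move=> c; rewrite (perm_big _ perm) -lebesgue_digit_set_iota; congr (lebesgue_measure _).
  rewrite /digit_set; congr (_ `&` _); apply/seteqP; split => u /= h k kI; apply: h.
    by rewrite (perm_mem perm).
  by rewrite -(perm_mem perm).
have : uniq (K ++ I) by rewrite (perm_uniq perm) iota_uniq.
elim: K HK {perm} => [|i K IH] HK; first by move=> _; exact: HK.
move=> /= /andP[iK uK]; apply: IH => //.
exact: (lebesgue_digit_set_drop iK).
Qed.

End coin_tosses.

Lemma pushforward_measure d1 d2 (T1 : measurableType d1) (T2 : measurableType d2) (R : realType)
    (m : {measure set T1 -> \bar R}) (f : T1 -> T2) : measurable_fun setT f ->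
  exists m2 : {measure set T2 -> \bar R}, forall B, m2 B = m (f @^-1` B).
Proof.
move=> mf; unshelve eexists (pushforward m f : {measure set T2 -> \bar R}); first exact: mf.
by [].
Qed.

Section product_measure.
Context {R : realType}.

(** Normalisation serves as packaging: with total mass 1 it leaves the measure unchanged, and the
    Dirac mass is its fallback for mass 0 or infinity. *)
Lemma probability_of_measure (m : {measure set borel_config -> \bar R}) :
  m setT = 1%E -> exists mu : probability borel_config R, forall B, mu B = m B.
Proof.
move=> m1; exists (mnormalize m (dirac ((fun=> false) : borel_config) : probability _ R)) => B.
have H (e : \bar R) (f g : set borel_config -> \bar R) : e = 1%E ->
    (if (e == 0)%E || (e == +oo)%E then f else fun U => (g U * ((fine e)^-1)%:E)%E) B = g B.
  by move=> ->; rewrite onee_eq0 /= invr1 mule1.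
exact: (H _ _ _ m1).
Qed.

Lemma product_bernoulli_exists (r0 r1 : R) : 0 <= r0 <= 1 -> 0 <= r1 <= 1 ->
  exists mu : probability borel_config R, product_bernoulli r0 r1 mu.
Proof.
move=> h0 h1.
pose rs (x : site) := if x.2 then r1 else r0.
(* Sites are countable: site [x] receives the digit of index [pickle x], and an index that codes no
   site gets the arbitrary parameter [r0]. *)
pose r n := if unpickle n is Some x then rs x else r0.
have r01 k : 0 <= r k <= 1 by rewrite /r /rs; case: unpickle => // -[z []].
have rE x : r (pickle x) = rs x by rewrite /r pickleK.
pose T u : borel_config := fun x => digit r u (pickle x).
have mT : measurable_fun setT T.
  apply: (@measurability _ _ R borel_config setT T (range scyl)); first by rewrite sigma_scyl.
  move=> _ [_ [s _ <-] <-]; rewrite setTI.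
  elim: s => [|[x v] s IH].
    by rewrite (_ : _ @^-1` _ = setT)//; apply/seteqP; split.
  rewrite (_ : _ @^-1` _ = [set u | digit r u (pickle x) = v] `&` T @^-1` scyl s).
    by apply: measurableI => //; exact: measurable_digit.
  apply/seteqP; split => u /=.
    move=> H; split; first exact: (H (x, v) (mem_head _ _)).
    by move=> e es; apply: H; rewrite inE es orbT.
  by move=> [H1 H2] e; rewrite inE => /predU1P[->|/H2].
have m01 : measurable (`[0, 1[%classic : set R) by [].
have [m mE] := pushforward_measure (mrestr (@lebesgue_measure R) m01) mT.
have cylE A c : uniq A -> m (cyl A c) = (\prod_(x <- A) bernoulli_pmf (rs x) (c x))%:E.
  move=> uA.
  pose b k := if unpickle k is Some x then c x else false.
  have := @lebesgue_digit_set R r r01 [seq pickle x | x <- A] b.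
  rewrite map_inj_uniq; last exact: (pcan_inj pickleK).
  move=> /(_ uA); rewrite big_map.
  under [in X in _ = X -> _]eq_bigr do rewrite rE /b pickleK.
  move=> <-; rewrite mE /= /mrestr; congr (lebesgue_measure _).
  rewrite setIC /digit_set; congr (_ `&` _); apply/seteqP; split => u /=.
    by move=> H _ /mapP[x xA ->]; rewrite /b pickleK -H.
  by move=> H x xA; rewrite -[LHS]/(digit r u (pickle x)) H ?map_f// /b pickleK.
have [mu muE] : exists mu : probability borel_config R, forall B, mu B = m B.
  apply: probability_of_measure.
  by have := cylE [::] (fun=> false) isT; rewrite cyl_nil big_nil.
by exists mu => A c uA; rewrite muE; exact: cylE.
Qed.

End product_measure.

(** * From adjacent exchanges to exchangeability *)

Lemma preimage_pull_cyl phi A (c : config) : injective phi ->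
  exists2 c' : config, pull phi @^-1` cyl A c = cyl [seq phi x | x <- A] c' &
    forall x, x \in A -> c' (phi x) = c x.
Proof.
move=> inj; pose c' : config := fun y => has (fun x => (phi x == y) && c x) A.
have c'E x : x \in A -> c' (phi x) = c x.
  move=> xA; apply/hasP/idP => [[y yA /andP[/eqP/inj -> //]]|cx].
  by exists x => //; rewrite eqxx.
exists c' => //; apply/seteqP; split=> eta /= H x.
  by move=> /mapP[y yA ->]; rewrite c'E// -H.
by move=> xA; rewrite /pull H ?map_f// c'E.
Qed.

Lemma pull_cyl_bij phi psi A (c : config) : {in A, cancel psi phi} ->
  pull phi @^-1` cyl [seq psi x | x <- A] (pull phi c) = cyl A c.
Proof.
move=> pK; apply/seteqP; split=> eta /= H x.
  by move=> xA; have := H (psi x) (map_f _ xA); rewrite /pull (pK _ xA).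
by move=> /mapP[y yA ->]; rewrite /pull (pK _ yA) H.
Qed.

Lemma sw_pull_bij phi psi u v (c : config) : cancel psi phi -> cancel phi psi ->
  sw (psi u) (psi v) (pull phi c) = pull phi (sw u v c).
Proof.
move=> pK pK'; apply/funext => z; rewrite /sw /pull /swp.
rewrite -!(can2_eq pK' pK).
by case: ifP => _; [rewrite pK|case: ifP => _; rewrite ?pK].
Qed.

Section exchangeability.
Context {R : realType}.
Implicit Types (mu nu : probability borel_config R) (A B : seq site).

Definition pull_invariant mu phi :=
  forall B : set borel_config, measurable B -> mu (pull phi @^-1` B) = mu B.

Lemma pull_invariant_cyl mu phi :
  (forall A c, uniq A -> mu (pull phi @^-1` cyl A c) = mu (cyl A c)) -> pull_invariant mu phi.
Proof.
move=> H B mB; have [m mE] := pushforward_measure mu (measurable_pull phi).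
rewrite -mE; apply: measure_eq_cyl => //.
  by rewrite mE preimage_setT -ge0_fin_numE// fin_num_measure.
by move=> A c uA; rewrite mE; exact: H.
Qed.

Lemma pull_invariant_comp mu phi psi :
  pull_invariant mu phi -> pull_invariant mu psi -> pull_invariant mu (phi \o psi).
Proof.
move=> H1 H2 B mB; rewrite -[RHS](H2 B mB) -[RHS](H1 _ (measurable_preimage_pull psi mB)).
by [].
Qed.

Lemma pull_invariant_eq mu phi psi : phi =1 psi -> pull_invariant mu phi -> pull_invariant mu psi.
Proof. by move=> /funext ->. Qed.

(** Conjugation lengthens a transposition by one adjacent step, so adjacent exchanges generate all
    transpositions of a lane. *)
Lemma swp_conj x y z : x != y -> y != z -> x != z ->
  swp x y \o (swp y z \o swp x y) =1 swp x z.
Proof.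
move=> xy yz xz w /=.
have [yx zy zx] : [/\ y != x, z != y & z != x] by rewrite (eq_sym y) (eq_sym z) (eq_sym z).
have [->|wx] := eqVneq w x; first by rewrite !swp_l swp_n.
have [->|wy] := eqVneq w y; first by rewrite swp_r (swp_n xy xz) swp_l swp_n.
have [->|wz] := eqVneq w z; last by rewrite !swp_n.
by rewrite (swp_n zx zy) !swp_r.
Qed.

Definition adjacent_exchange mu := forall (z : int) i A c,
  (z - 1, i) \in A -> (z, i) \in A -> pr mu A (sw (z - 1, i) (z, i) c) = pr mu A c.

Section transpositions.
Variable mu : probability borel_config R.
Hypothesis adj : adjacent_exchange mu.

Lemma adjacent_pull_invariant (z : int) i : pull_invariant mu (swp (z - 1, i) (z, i)).
Proof.
set x := (z - 1, i); set y := (z, i).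
apply: pull_invariant_cyl => A c uA.
set B := undup (x :: y :: A).
have [xB yB] : x \in B /\ y \in B by rewrite !mem_undup !inE !eqxx orbT.
have uB : uniq B by exact: undup_uniq.
have dB : dep B (@indc R A c).
  by apply: dep_sub (@dep_indc R A c) => w wA; rewrite mem_undup !inE wA !orbT.
have mA := measurable_cyl A c.
rewrite prE -[mu (pull _ @^-1` _)]fineK; last first.
  by apply: fin_num_measure; exact: measurable_preimage_pull.
congr (_%:E); rewrite -(ev_ind mu) /=; last exact: measurable_preimage_pull.
rewrite -ev_indc -[LHS]/(ev mu (fun eta => indc A c (sw x y eta))).
rewrite (ev_dep mu uB dB) (ev_dep mu uB (dep_sw xB yB dB)).
rewrite -[RHS](sum_cfgs_involution _ uB (sw_local xB yB)); apply: eq_bigr => e _ /=.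
by rewrite adj.
Qed.

Lemma transposition_invariant_dist n (z : int) i : pull_invariant mu (swp (z, i) (z + n.+1%:Z, i)).
Proof.
elim: n => [|n IH].
  by have := adjacent_pull_invariant (z + 1) i; rewrite addrK.
have := adjacent_pull_invariant (z + n.+2%:Z) i.
have -> : z + n.+2%:Z - 1 = z + n.+1%:Z by lia.
move=> H; apply: (pull_invariant_eq (swp_conj (x := (z, i)) (y := (z + n.+1%:Z, i)) _ _ _)).
- by apply/eqP => -[]; lia.
- by apply/eqP => -[]; lia.
- by apply/eqP => -[]; lia.
- by apply: pull_invariant_comp => //; exact: pull_invariant_comp.
Qed.

Lemma transposition_invariant x y : x.2 = y.2 -> pull_invariant mu (swp x y).
Proof.
case: x y => z i [z' j] /= <-.
have [zz'|zz'|->] := ltgtP z z'.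
- have -> : z' = z + (`|(z' - z)%R|%N.-1).+1%:Z by lia.
  exact: transposition_invariant_dist.
- rewrite swpC; have -> : z = z' + (`|(z - z')%R|%N.-1).+1%:Z by lia.
  exact: transposition_invariant_dist.
- apply: (pull_invariant_eq (phi := id)) => // w.
  by rewrite /swp; case: eqP => // ->.
Qed.

(* On a finite set of sites an injection agrees with a product of transpositions. *)
Lemma adjacent_exchangeable : exchangeable mu.
Proof.
move=> phi inj lp; apply: pull_invariant_cyl => A c uA.
have [pi [pinv pinj plp pA]] : exists pi, [/\ pull_invariant mu pi, injective pi,
    lane_preserving pi & {in A, pi =1 phi}].
  elim: A uA => [|x A IH] /=.
    by move=> _; exists id; split.
  move=> /andP[xA /IH[pi [pinv pinj plp pA]]].
  exists (swp (pi x) (phi x) \o pi); split.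
  - apply: pull_invariant_comp => //; apply: transposition_invariant.
    by rewrite plp lp.
  - by apply: inj_comp => //; exact: swp_inj.
  - by move=> w /=; rewrite swp_lane// plp lp.
  - move=> w; rewrite inE => /predU1P[->|wA] /=; first by rewrite swp_l.
    have wx : w != x by apply: contraNneq xA => <-.
    have h1 : pi w != pi x by rewrite (inj_eq pinj).
    have h2 : pi w != phi x by rewrite pA// (inj_eq inj).
    by rewrite (swp_n h1 h2) pA.
rewrite -(pinv _ (measurable_cyl A c)); congr (mu _).
by apply/seteqP; split=> eta /= H x xA; rewrite -H// /pull pA.
Qed.

End transpositions.

(** Shifting lane 1 alone by [z' - z] preserves lanes, so exchangeability lets [v] be brought into
    the column of [u]. *)
Lemma balanced_same_column p q mu : exchangeable mu ->
  (forall z A c, (z, false) \in A -> (z, true) \in A -> c (z, false) = true -> c (z, true) = false ->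
    p * pr mu A c = q * pr mu A (sw (z, false) (z, true) c)) ->
  balanced p q mu.
Proof.
move=> ex H A c [z i] [z' j] /= -> -> uA vA cu cv.
pose phi (x : site) : site := if x.2 then (x.1 + (z' - z), x.2) else x.
pose psi (x : site) : site := if x.2 then (x.1 - (z' - z), x.2) else x.
have pK : cancel psi phi by move=> [w []]; rewrite /phi /psi /= ?subrK.
have pK' : cancel phi psi by move=> [w []]; rewrite /phi /psi /= ?addrK.
have lp : lane_preserving phi by move=> [w []].
have E c0 : pr mu A c0 = pr mu [seq psi x | x <- A] (pull phi c0).
  rewrite /pr -(@pull_cyl_bij phi psi A c0 (in1W pK)); congr fine; apply: ex => //.
    exact: can_inj pK'.
  exact: measurable_cyl.
have Eu : psi (z, false) = (z, false) by [].
have Ev : psi (z', true) = (z, true) by rewrite /psi /= opprB addrC subrK.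
rewrite !E -(sw_pull_bij _ _ _ pK pK') Eu Ev; apply: H.
- by rewrite -Eu map_f.
- by rewrite -Ev map_f.
- by rewrite /pull -Eu pK.
- by rewrite /pull -Ev pK.
Qed.

Section product.
Variables (r0 r1 : R) (nu : probability borel_config R).
Hypothesis hnu : product_bernoulli r0 r1 nu.

Let rs (x : site) := if x.2 then r1 else r0.

Lemma pr_product A c : uniq A -> pr nu A c = \prod_(x <- A) bernoulli_pmf (rs x) (c x).
Proof. by move=> uA; rewrite /pr hnu. Qed.

Lemma product_exchangeable : exchangeable nu.
Proof.
move=> phi inj lp; apply: pull_invariant_cyl => A c uA.
have [c' -> c'E] := preimage_pull_cyl A c inj.
rewrite !hnu ?map_inj_uniq//; congr (_%:E).
by rewrite big_map; apply: eq_big_seq => x xA; rewrite lp c'E.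
Qed.

Lemma product_balanced p q : p * r0 * (1 - r1) = q * r1 * (1 - r0) -> balanced p q nu.
Proof.
move=> H A c u v u2 v2 uA vA cu cv.
have uv : u != v by apply/eqP => E; move: u2; rewrite E v2.
set L := [seq x <- undup A | (x != u) && (x != v)].
have perm : perm_eq (undup A) (u :: v :: L).
  apply: uniq_perm; first exact: undup_uniq.
    rewrite /= !inE !mem_filter !eqxx /= andbF (negbTE uv) /= filter_uniq//; exact: undup_uniq.
  move=> x; rewrite !inE mem_filter mem_undup.
  by have [->|] := eqVneq x u; [rewrite uA|have [->|] := eqVneq x v; rewrite /= ?vA].
have E e : pr nu A e = bernoulli_pmf (rs u) (e u) * (bernoulli_pmf (rs v) (e v) *
    \prod_(x <- L) bernoulli_pmf (rs x) (e x)).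
  rewrite (_ : pr nu A e = pr nu (undup A) e); last first.
    by rewrite /pr; congr (fine (nu _)); apply: eq_mem_cyl => x; rewrite mem_undup.
  by rewrite pr_product ?undup_uniq// (perm_big _ perm) !big_cons.
rewrite !E /sw swp_l swp_r cu cv /bernoulli_pmf /rs u2 v2.
have -> : \prod_(x <- L) (if c (swp u v x) then if x.2 then r1 else r0 else 1 - (if x.2 then r1 else r0)) =
  \prod_(x <- L) (if c x then if x.2 then r1 else r0 else 1 - (if x.2 then r1 else r0)).
  by apply: eq_big_seq => x; rewrite mem_filter => /andP[/andP[xu xv] _]; rewrite swp_n.
by rewrite !mulrA H; ring.
Qed.

Lemma product_pr_gt0 : 0 < r0 < 1 -> 0 < r1 < 1 -> forall A c, 0 < pr nu A c.
Proof.
move=> h0 h1 A c.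
rewrite (_ : pr nu A c = pr nu (undup A) c); last first.
  by rewrite /pr; congr (fine (nu _)); apply: eq_mem_cyl => x; rewrite mem_undup.
rewrite pr_product ?undup_uniq//; apply: prodr_gt0 => x _.
by rewrite /rs /bernoulli_pmf; case: (c x); case: (x.2); lra.
Qed.

End product.

Section average.
Variables (mu nu : probability borel_config R).

Lemma average_exists : exists m : probability borel_config R,
  forall B : set borel_config, measurable B -> m B = (2^-1%:E * mu B + 2^-1%:E * nu B)%E.
Proof.
have h2 : 0 <= 2^-1 :> R by rewrite invr_ge0.
pose m := measure_add (mscale (NngNum h2) mu) (mscale (NngNum h2) nu).
have mE (B : set borel_config) : m B = (2^-1%:E * mu B + 2^-1%:E * nu B)%E by rewrite /m measure_addE.
have [m' m'E] : exists m' : probability borel_config R, forall B : set borel_config, m' B = m B.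
  apply: (@probability_of_measure _ m); transitivity (m setT) => //.
  transitivity (2^-1%:E * 1 + 2^-1%:E * 1 : \bar R)%E.
    by rewrite mE; congr (_ * _ + _ * _)%E; exact: probability_setT.
  by rewrite !mule1 -EFinD; congr (_%:E); lra.
by exists m' => B mB; rewrite m'E.
Qed.

Variable m : probability borel_config R.
Hypothesis mE : forall B : set borel_config, measurable B -> m B = (2^-1%:E * mu B + 2^-1%:E * nu B)%E.

Lemma pr_average A c : pr m A c = 2^-1 * pr mu A c + 2^-1 * pr nu A c.
Proof. by rewrite {1}/pr mE ?prE//; exact: measurable_cyl. Qed.

Lemma ev_average f : cylinder_function f -> ev m f = 2^-1 * ev mu f + 2^-1 * ev nu f.
Proof.
move=> [A dA]; have dB : dep (undup A) f by apply: dep_sub dA => x; rewrite mem_undup.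
have uA := undup_uniq A.
rewrite !(ev_dep _ uA dB) !mulr_sumr -big_split /=; apply: eq_bigr => c _.
by rewrite pr_average; ring.
Qed.

End average.

End exchangeability.

(** * Stationary measures are exchangeable and balanced *)

Lemma exchangeable_pr_sw (R : realType) (mu : probability borel_config R) x y A c :
  exchangeable mu -> x.2 = y.2 -> x \in A -> y \in A -> pr mu A (sw x y c) = pr mu A c.
Proof.
move=> ex xy xA yA; rewrite /pr -(ex (swp x y) (@swp_inj x y) (swp_lane xy) _ (measurable_cyl A c)).
congr (fine (mu _)); apply/seteqP; split=> eta /= H z zA.
  by rewrite /pull H ?mem_swp// /sw swpK.
by rewrite -[LHS]/(eta z) -[z in LHS](swpK x y) -[LHS]/(pull (swp x y) eta (swp x y z)) H ?mem_swp.
Qed.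

Section classification.
Context {R : realType}.
Implicit Types (p q d l a : R) (mu nu : probability borel_config R).

Lemma dep_pregenerator p q d0 l0 d1 l1 c n (f : config -> R) : dep (box c n) f ->
  dep (box (c - 1) n.+2) (pregenerator p q d0 l0 d1 l1 f).
Proof.
move=> df eta zeta H; rewrite !(pregenerator_box _ _ _ _ _ _ _ df).
have J x y : x \in box (c - 1) n.+2 -> y \in box (c - 1) n.+2 ->
    jump x y f eta = jump x y f zeta.
  move=> xB yB; apply: (dep_jump df) => z; rewrite !inE => /or3P[/eqP ->|/eqP ->|zB]; apply: H => //.
  by move: zB; rewrite !mem_box; lia.
congr (_ + _); apply: eq_big_seq => k; rewrite mem_iota add0n => /andP[_ kn].
  by apply: eq_bigr => i _; congr (_ * _ + _ * _); apply: J; rewrite mem_box /=; clear -kn; lia.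
by congr (_ * _ + _ * _); apply: J; rewrite mem_box /=; clear -kn; lia.
Qed.

Lemma cylinder_pregenerator p q d0 l0 d1 l1 (f : config -> R) :
  cylinder_function f -> cylinder_function (pregenerator p q d0 l0 d1 l1 f).
Proof.
move=> [A dA]; have [c [n AB]] := box_sub A.
by exists (box (c - 1) n.+2); apply: dep_pregenerator; exact: dep_sub AB dA.
Qed.

Definition stationary p q d0 l0 d1 l1 mu :=
  forall f, cylinder_function f -> ev mu (pregenerator p q d0 l0 d1 l1 f) = 0.

Lemma stationary_exchange p q d0 l0 d1 l1 a mu :
  0 <= p -> 0 <= q -> 0 <= d0 -> 0 <= l0 -> 0 <= d1 -> 0 <= l1 ->
  0 < d0 + l0 -> 0 < d1 + l1 -> 0 < a -> p = q * a ->
  translation_invariant mu -> stationary p q d0 l0 d1 l1 mu ->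
  adjacent_exchange mu /\
  (0 < p -> forall z A c, (z, false) \in A -> (z, true) \in A ->
    c (z, false) = true -> c (z, true) = false ->
    p * pr mu A c = q * pr mu A (sw (z, false) (z, true) c)).
Proof.
move=> p0 q0 d00 l00 d10 l10 dl0 dl1 a0 pqa tinv st.
have a1 : 0 < 1 + a by rewrite addr_gt0.
have r0 : 0 < (2^-1 : R) < 1 by rewrite invr_gt0 ltr0n invf_lt1// ltr1n.
have r1 : 0 < a / (1 + a) < 1.
  by rewrite divr_gt0//= ltr_pdivrMr// mul1r ltrDr.
(* The densities [1 / 2] and [a / (1 + a)] have odds 1 and [a], so [p = q * a] is their detailed
   balance. *)
have [nu hnu] : exists nu : probability borel_config R, product_bernoulli (2^-1) (a / (1 + a)) nu.
  by apply: product_bernoulli_exists; apply/andP; split; lra.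
have nuex := product_exchangeable hnu.
have nubal : balanced p q nu.
  by apply: (product_balanced hnu); rewrite pqa; field; rewrite gt_eqF.
have nupos := product_pr_gt0 hnu r0 r1.
have [m mE] := average_exists mu nu.
have mpos A c : 0 < pr m A c.
  rewrite (pr_average mE); have := nupos A c; have := pr_ge0 mu A c; lra.
have mtinv : translation_invariant m.
  move=> k B mB; rewrite !mE//; last by rewrite pull_translate; exact: measurable_preimage_pull.
  by rewrite tinv// (exchangeable_translation nuex).
have mst f : cylinder_function f -> ev m (pregenerator p q d0 l0 d1 l1 f) = 0.
  move=> cf; rewrite (ev_average mE (cylinder_pregenerator _ _ _ _ _ _ cf)).
  by rewrite st// exchangeable_balanced_generator// !mulr0 addr0.
split.
- move=> z i A c xA yA.
  set x := (z - 1, i); set y := (z, i).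
  suff E : pr m A c = pr m A (sw x y c).
    move: E; rewrite !(pr_average mE) (exchangeable_pr_sw (x := x) (y := y) _ nuex)//; lra.
  have hx (e : config) : e x -> ~~ e y -> pr m A e = pr m A (sw x y e).
    have : 0 < dd d0 d1 i + ll l0 l1 i by rewrite /dd /ll; case: (i).
    have dge : 0 <= dd d0 d1 i by rewrite /dd; case: (i).
    have lge : 0 <= ll l0 l1 i by rewrite /ll; case: (i).
    (* If the rate to the right vanishes on this lane, the rate to the left does not, and the
       backward bond gives the identity from the exchanged pattern. *)
    have [d_gt0 _ ex ey|d_le0 dl ex ey] := ltP 0 (dd d0 d1 i).
      have := @horizontal_exchange R p q d0 l0 d1 l1 a m p0 q0 d00 l00 d10 l10 a0 pqa mpos mtinv mst A z i true e.
      by apply.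
    have l_gt0 : 0 < ll l0 l1 i by lra.
    have := @horizontal_exchange R p q d0 l0 d1 l1 a m p0 q0 d00 l00 d10 l10 a0 pqa mpos mtinv mst A z i false (sw x y e).
    rewrite /= -/x -/y => H; rewrite H//.
    - by rewrite swC swK.
    - by rewrite /sw swp_r.
    - by rewrite /sw swp_l.
  (* Equal contents make the exchange trivial, and the opposite order of contents follows from [hx]
     by involution. *)
  have [cx|cx] := boolP (c x); have [cy|cy] := boolP (c y).
  + congr (pr m A _); apply/funext => w; rewrite /sw /swp.
    by case: eqP => [->|_]; [rewrite cx cy|case: eqP => // ->; rewrite cx cy].
  + exact: hx.
  + by rewrite [RHS]hx ?swK// /sw ?swp_l ?swp_r.
  + congr (pr m A _); apply/funext => w; rewrite /sw /swp.
    by case: eqP => [->|_]; [rewrite (negbTE cx) (negbTE cy)|case: eqP => // ->; rewrite (negbTE cx) (negbTE cy)].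
- move=> pp z A c uA vA cu cv.
  have q1 : 0 < q by rewrite lt_def q0 andbT; apply/eqP => q00; move: pp; rewrite pqa q00 mul0r ltxx.
  have := @vertical_exchange R p q d0 l0 d1 l1 a m p0 q0 d00 l00 d10 l10 a0 pqa mpos mtinv mst A z c pp uA vA.
  rewrite cu cv => /(_ isT isT) E.
  have Em : p * pr m A c = q * pr m A (sw (z, false) (z, true) c).
    by rewrite E pqa; field; rewrite gt_eqF.
  have En := nubal A c (z, false) (z, true) erefl erefl uA vA cu cv.
  move: Em; rewrite !(pr_average mE); lra.
Qed.

Lemma ev_jp_pr mu x y : x != y ->
  ev mu (jp x y) = pr mu [:: x; y] (fun z => z == x).
Proof.
move=> xy; rewrite -ev_indc; congr ev; apply/funext => eta.
rewrite jp01 /indc; congr (nat_of_bool _)%:R; apply/esym/asbool_equiv_eqP; first exact: andP.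
split=> [H|[ex ey] z].
  by rewrite !H ?inE ?eqxx ?orbT// eq_sym xy.
rewrite !inE => /orP[] /eqP ->; first by rewrite eqxx ex.
by rewrite eq_sym (negbTE xy); apply/negbTE.
Qed.

Lemma ev_jp_translate mu k x y : translation_invariant mu -> x != y ->
  ev mu (jp (trs k x) (trs k y)) = ev mu (jp x y).
Proof.
move=> tinv xy; have txy : trs k x != trs k y by rewrite (inj_eq (can_inj (trsK k))).
rewrite !ev_jp_pr// -[RHS](pr_translate tinv k) /=; congr (fine (mu _)); apply: eq_cyl => z _.
by rewrite /trc /pull (can2_eq (trsNK k) (trsK k)).
Qed.

(* When q = 0 the mean of the occupation of a lane-0 site can only decrease,
   so stationarity forbids vertical jumps altogether. *)
Lemma stationary_no_vertical p d0 l0 d1 l1 mu : 0 < p ->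
  translation_invariant mu -> stationary p 0 d0 l0 d1 l1 mu ->
  forall z, ev mu (jp (z, false) (z, true)) = 0.
Proof.
move=> pp tinv st.
pose o : site := (0, false).
suff E0 : ev mu (jp (0, false) (0, true)) = 0.
  move=> z; rewrite -[RHS]E0 -(ev_jp_translate z (x := (0, false)) (y := (0, true)) tinv)//.
  by rewrite /trs /= add0r.
pose f (eta : config) : R := (eta o)%:R.
have df : dep (box 0 1) f by move=> eta zeta H; rewrite /f H// mem_box.
have cf : cylinder_function f by exists (box 0 1).
have := st f cf; rewrite (ev_pregenerator_box _ _ _ _ _ _ _ df).
rewrite /hsum /vsum /= !big_cons !big_nil !addr0 mul0r addr0 /dd /ll /=.
have Jn x y : x != o -> y != o -> ev mu (jump x y f) = 0.
  move=> xo yo; rewrite -[RHS](ev_cst mu 0); congr ev; apply/funext => eta.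
  by rewrite /jump /f /sw swp_n ?subrr ?mulr0// eq_sym.
have Jo x : x != o -> ev mu (jump x o f) = ev mu (jp x o).
  move=> xo; congr ev; apply/funext => eta; rewrite /jump /f /sw swp_r jp01.
  by case: (eta x); case: (eta o); rewrite /= ?mul0r ?subr0 ?mulr1.
have oJ x : x != o -> ev mu (jump o x f) = - ev mu (jp o x).
  move=> xo; rewrite -mulN1r -ev_scale; last exact: continuous_jp.
  congr ev; apply/funext => eta; rewrite /jump /f /sw swp_l jp01.
  by case: (eta x); case: (eta o); rewrite /= ?(mul0r,mulr0,subrr) ?mulr1 ?mul1r ?sub0r.
pose om : site := (-1, false); pose op : site := (1%:Z, false).
(* Translation matches the flow into [o] on one side with the flow out of it on the other, for each
   direction, so only the vertical loss survives. *)
have T1 : ev mu (jp om o) = ev mu (jp o op).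
  by rewrite -(ev_jp_translate 1 (x := om) (y := o) tinv).
have T2 : ev mu (jp op o) = ev mu (jp o om).
  by rewrite -(ev_jp_translate (-1) (x := op) (y := o) tinv).
rewrite !add0r subrr -/o -/om -/op.
rewrite (Jn (-1, true) (0, true))// (Jn (0, true) (-1, true))//.
rewrite (Jn (0, true) (1%:Z, true))// (Jn (1%:Z, true) (0, true))//.
rewrite (Jo om)// (Jo op)// (oJ om)// (oJ op)// (oJ (0, true))// T1 T2 => E.
have : p * ev mu (jp o (0, true)) = 0 by move: E; rewrite !mulr0; lra.
by move/eqP; rewrite mulf_eq0 gt_eqF//= => /eqP.
Qed.

(** The increment of [f] across a vertical jump is at most [2 * M] in absolute value and lives on a
    null event, so its mean vanishes for every [f]. *)
Lemma stationary_drop_vertical p d0 l0 d1 l1 mu :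
  (forall z, ev mu (jp (z, false) (z, true)) = 0) ->
  stationary p 0 d0 l0 d1 l1 mu -> stationary 0 0 d0 l0 d1 l1 mu.
Proof.
move=> J0 st f [A dA]; have [c [n AB]] := box_sub A.
have df := dep_sub AB dA.
have cf : cylinder_function f by exists (box c n).
rewrite -[RHS](st f cf) !(ev_pregenerator_box _ _ _ _ _ _ _ df); congr (_ + _).
apply: eq_bigr => k _; rewrite !mul0r; congr (_ + _).
set x := (_, false); set y := (_, true).
suff -> : ev mu (jump x y f) = 0 by rewrite mulr0.
have [M M0 HM] := continuous_bounded (dep_continuous df).
apply/eqP; rewrite -normr_le0.
have cj := continuous_jump (x := x) (y := y) df.
have b eta : `|jump x y f eta| <= 2 * M * jp x y eta.
  rewrite /jump jp01; case: (_ && _); last by rewrite mul0r normr0 mulr0.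
  rewrite mul1r mulr1 (le_trans (ler_normB _ _))// mulr_natl mulr2n lerD//.
have cb := continuous_scale (a := 2 * M) (@continuous_jp R x y).
have h1 : ev mu (jump x y f) <= 0.
  rewrite -(mulr0 (2 * M)) -(J0 (c + k%:Z)) -ev_scale; last exact: continuous_jp.
  by apply: ev_le => // eta; apply: le_trans (b eta); exact: ler_norm.
have h2 : 0 <= ev mu (jump x y f).
  rewrite -oppr_le0 -mulN1r -ev_scale// -(mulr0 (2 * M)) -(J0 (c + k%:Z)) -ev_scale; last exact: continuous_jp.
  apply: ev_le => //; first exact: continuous_scale.
  by move=> eta; apply: le_trans (b eta); rewrite mulN1r -normrN; exact: ler_norm.
by rewrite (@le_anti _ _ (ev mu (jump x y f)) 0) ?normr0// h1 h2.
Qed.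

Lemma stationary_exchangeable_balanced p q d0 l0 d1 l1 mu :
  0 < p -> 0 <= q -> 0 <= d0 -> 0 <= l0 -> 0 <= d1 -> 0 <= l1 ->
  0 < d0 + l0 -> 0 < d1 + l1 ->
  translation_invariant mu -> stationary p q d0 l0 d1 l1 mu ->
  exchangeable mu /\ balanced p q mu.
Proof.
move=> pp q0 d00 l00 d10 l10 dl0 dl1 tinv st.
have [q00|qN0] := eqVneq q 0.
  rewrite q00 in st *.
  have J0 := stationary_no_vertical pp tinv st.
  have st0 := stationary_drop_vertical J0 st.
  (* Once both vertical rates are 0, the relation [p = q * a] holds for any weight; [a = 1] is
     taken. *)
  have [adj _] := @stationary_exchange 0 0 d0 l0 d1 l1 1 mu (lexx _) (lexx _)
    d00 l00 d10 l10 dl0 dl1 ltr01 (esym (mul0r _)) tinv st0.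
  have ex := adjacent_exchangeable adj; split => //.
  apply: balanced_same_column => // z A c uA vA cu cv.
  (* For [q = 0] balance says that the pattern is null, which holds because it lies in the event
     where a vertical jump is allowed. *)
  rewrite mul0r; apply/eqP; rewrite mulf_eq0 gt_eqF//=.
  apply/eqP/le_anti; rewrite pr_ge0 andbT -(J0 z) -ev_indc.
  apply: ev_le; [exact: dep_continuous (@dep_indc R A c)|exact: continuous_jp|].
  move=> eta; rewrite /indc jp01.
  have [H|H] := pselect (cyl A c eta); last by rewrite asboolF.
  by rewrite asboolT// !H// cu cv.
have qp : 0 < q by rewrite lt_def qN0.
have pqa : p = q * (p / q) by rewrite mulrC divfK.
have [adj bal] := @stationary_exchange p q d0 l0 d1 l1 (p / q) mu (ltW pp) q0
  d00 l00 d10 l10 dl0 dl1 (divr_gt0 pp qp) pqa tinv st.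
have ex := adjacent_exchangeable adj; split => //.
by apply: balanced_same_column => //; exact: bal.
Qed.

End classification.

(** * Ergodicity of product measures and conditioning *)

Section cylinder_closure.
Context {R : realType}.
Implicit Types f g : config -> R.

Lemma cylinder_add f g : cylinder_function f -> cylinder_function g ->
  cylinder_function (fun eta => f eta + g eta).
Proof.
move=> [A dA] [B dB]; exists (A ++ B) => eta zeta H.
by rewrite (dA eta zeta) ?(dB eta zeta)// => x xA; apply: H; rewrite mem_cat xA ?orbT.
Qed.

Lemma cylinder_mul f g : cylinder_function f -> cylinder_function g ->
  cylinder_function (fun eta => f eta * g eta).
Proof.
move=> [A dA] [B dB]; exists (A ++ B) => eta zeta H.
by rewrite (dA eta zeta) ?(dB eta zeta)// => x xA; apply: H; rewrite mem_cat xA ?orbT.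
Qed.

Lemma cylinder_cst (a : R) : cylinder_function (fun=> a).
Proof. by exists [::]. Qed.

Lemma cylinder_sum (I : Type) (s : seq I) (F : I -> config -> R) :
  (forall i, cylinder_function (F i)) -> cylinder_function (fun eta => \sum_(i <- s) F i eta).
Proof.
move=> cF; elim: s => [|i s IH].
  by under eq_fun do rewrite big_nil; exact: cylinder_cst.
by under eq_fun do rewrite big_cons; exact: cylinder_add.
Qed.

Lemma cylinder_continuous f : cylinder_function f -> continuous f.
Proof. by move=> [A dA]; exact: dep_continuous dA. Qed.

End cylinder_closure.

Section ergodicity.
Context {R : realType}.
Variables (r0 r1 a : R) (nu mu : probability borel_config R).
Hypothesis hnu : product_bernoulli r0 r1 nu.
Hypothesis tinv : translation_invariant mu.
Hypothesis a0 : 0 < a.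
Hypothesis dom : forall A c, a * pr mu A c <= pr nu A c.

Lemma dominated_ev f : cylinder_function f -> (forall eta, 0 <= f eta) -> a * ev mu f <= ev nu f.
Proof.
move=> [A dA] f0; have dB : dep (undup A) f by apply: dep_sub dA => x; rewrite mem_undup.
rewrite !(ev_dep _ (undup_uniq A) dB) mulr_sumr; apply: ler_sum => c _.
by rewrite mulrCA ler_wpM2l.
Qed.

Lemma ev_square_le (f : config -> R) : cylinder_function f ->
  ev mu f ^+ 2 <= ev mu (fun eta => f eta * f eta).
Proof.
move=> cf; have cf2 := cylinder_mul cf cf.
have c1 := cylinder_continuous cf; have c2 := cylinder_continuous cf2.
have : 0 <= ev mu (fun eta => f eta * f eta - (2 * ev mu f * f eta - ev mu f ^+ 2)).
  by apply: ev_ge0 => eta; have := sqr_ge0 (f eta - ev mu f); congr (_ <= _); ring.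
have c3 := continuous_scale (a := 2 * ev mu f) c1.
rewrite ev_sub//; last by apply: continuous_sub => //; exact: continuous_cst.
rewrite ev_sub//; last exact: continuous_cst.
by rewrite ev_cst ev_scale//; nra.
Qed.

(* Law of large numbers in L2(nu) along translates with disjoint supports. *)
Lemma dominated_product_pr A c : uniq A -> pr mu A c = pr nu A c.
Proof.
move=> uA; have [c0 [m Am]] := box_sub A.
pose s k : int := k%:Z * m%:Z.
pose Ak k := [seq trs (s k) x | x <- A].
pose X k := @indc R (Ak k) (trc (s k) c).
set y := pr nu A c.
have cX k : cylinder_function (X k) by exists (Ak k); exact: dep_indc.
have nutinv := exchangeable_translation (product_exchangeable hnu).
have Xnu k : ev nu (X k) = y by rewrite ev_indc pr_translate.
have Xmu k : ev mu (X k) = pr mu A c by rewrite ev_indc pr_translate.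
have uAk k : uniq (Ak k) by rewrite map_inj_uniq//; exact: can_inj (trsK _).
have XX j k : ev nu (fun eta => X j eta * X k eta) = if j == k then y else y * y.
  have [->|jk] := eqVneq j k.
    rewrite -(Xnu k); congr ev; apply/funext => eta.
    by rewrite /X /indc; case: asboolP => _; rewrite ?mulr1 ?mulr0.
  have disj x : x \in Ak j -> x \notin Ak k.
    move=> /mapP[x1 /Am + ->]; rewrite mem_box => h1.
    apply/negP => /mapP[x2 /Am + /(congr1 fst) /=]; rewrite mem_box /s => h2 E.
    by clear -h1 h2 E jk; nia.
  (* Glues the two patterns with disjoint supports, so that the product of their indicators is again
     a cylinder indicator. *)
  pose e w := if w \in Ak j then trc (s j) c w else trc (s k) c w.
  have ej : {in Ak j, e =1 trc (s j) c} by move=> w wA; rewrite /e wA.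
  have ek : {in Ak k, e =1 trc (s k) c}.
    by move=> w wA; rewrite /e; case: ifP => // /disj; rewrite wA.
  have -> : (fun eta => X j eta * X k eta) = indc (Ak j ++ Ak k) e.
    apply/funext => eta; rewrite /X /indc -natrM mulnb; congr (nat_of_bool _)%:R.
    apply/esym/asbool_equiv_eqP; first exact: andP.
    rewrite cyl_cat (eq_cyl ej) (eq_cyl ek); split => [[h1 h2]|[/asboolP h1 /asboolP h2]] //.
    by split; apply/asboolP.
  rewrite ev_indc (pr_product hnu); last first.
    rewrite cat_uniq !uAk andbT /=; apply/hasPn => w wk; apply/negP => /disj.
    by rewrite wk.
  rewrite big_cat /=; congr (_ * _).
    rewrite -(Xnu j) ev_indc (pr_product hnu)//.
    by apply: eq_big_seq => w wA; rewrite ej.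
  rewrite -(Xnu k) ev_indc (pr_product hnu)//.
  by apply: eq_big_seq => w wA; rewrite ek.
pose D k eta := X k eta - y.
have cD k : cylinder_function (D k).
  exact: (cylinder_add (cX k) (cylinder_cst (- y))).
(* Distinct translates have covariance 0, and the variance [y - y ^ 2] is at most 1. *)
have DD j k : ev nu (fun eta => D j eta * D k eta) <= (j == k)%:R.
  have c1 := cylinder_continuous (cX j); have c2 := cylinder_continuous (cX k).
  have c12 := cylinder_continuous (cylinder_mul (cX j) (cX k)).
  have c3 := continuous_scale (a := y) c1; have c4 := continuous_scale (a := y) c2.
  have -> : (fun eta => D j eta * D k eta) =
    (fun eta => X j eta * X k eta - ((y * X j eta + y * X k eta) - y * y)).
    by apply/funext => eta; rewrite /D; ring.
  have c5 := continuous_add c3 c4.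
  rewrite ev_sub//; last by apply: continuous_sub => //; exact: continuous_cst.
  rewrite ev_sub//; last exact: continuous_cst.
  rewrite ev_cst ev_add// (ev_scale _ _ c1) (ev_scale _ _ c2) !Xnu XX.
  have y0 : 0 <= y by exact: pr_ge0.
  have y1 : y <= 1.
    rewrite -(ev_cst nu 1) /y -ev_indc; apply: ev_le; [exact: dep_continuous (@dep_indc R A c)|exact: continuous_cst|].
    by move=> eta; rewrite /indc; case: asboolP.
  by case: eqP => _ /=; nra.
suff : (pr mu A c - y) ^+ 2 <= 0.
  rewrite le_eqVlt ltNge sqr_ge0 orbF sqrf_eq0 subr_eq0 => /eqP //.
(* Let [Z] be the sum of [n] centred indicators and [delta] the difference [pr mu A c - y]. Then [a
   n^2 delta^2 <= a E_mu Z^2 <= E_nu Z^2 <= n], so [n delta^2] is at most [a^-1] for every [n]. *)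
apply: (@archimedean_le0 _ a^-1) => n.
have [->|n0] := eqVneq n 0%N; first by rewrite mul0r invr_ge0 ltW.
pose Z eta := \sum_(k <- iota 0 n) D k eta.
have cZ : cylinder_function Z by exact: cylinder_sum.
have ZZ : ev nu (fun eta => Z eta * Z eta) <= n%:R.
  have -> : (fun eta => Z eta * Z eta) =
    (fun eta => \sum_(j <- iota 0 n) \sum_(k <- iota 0 n) D j eta * D k eta).
    apply/funext => eta; rewrite /Z mulr_suml; apply: eq_bigr => j _.
    by rewrite mulr_sumr.
  have cDD j k := cylinder_continuous (cylinder_mul (cD j) (cD k)).
  rewrite ev_sum; last by move=> j; apply: continuous_sum => k; exact: cDD.
  have -> : n%:R = \sum_(j <- iota 0 n) (1 : R).
    by rewrite big_const_seq count_predT size_iota iter_addr_0.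
  rewrite big_seq [leRHS]big_seq; apply: ler_sum => j jn.
  rewrite ev_sum; last by move=> k; exact: cDD.
  apply: (@le_trans _ _ (\sum_(k <- iota 0 n) (j == k)%:R)); first by apply: ler_sum => k _; exact: DD.
  rewrite (bigD1_seq j) ?iota_uniq//= eqxx big1 ?addr0// => k.
  by rewrite eq_sym => /negbTE ->.
have EZ : ev mu Z = n%:R * (pr mu A c - y).
  rewrite ev_sum; last by move=> k; exact: cylinder_continuous.
  have -> : \sum_(k <- iota 0 n) ev mu (D k) = \sum_(k <- iota 0 n) (pr mu A c - y).
    apply: eq_bigr => k _; rewrite /D ev_sub ?Xmu ?ev_cst//; last exact: continuous_cst.
    exact: cylinder_continuous.
  by rewrite big_const_seq count_predT size_iota iter_addr_0 mulr_natl.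
have h1 := ev_square_le cZ.
have h2 := dominated_ev (cylinder_mul cZ cZ) (fun eta => sqr_ge0 (Z eta)).
have h3 : a * (n%:R * (pr mu A c - y)) ^+ 2 <= n%:R.
  rewrite -EZ; apply: le_trans ZZ; apply: le_trans h2; exact: ler_wpM2l (ltW a0) _ _ h1.
have np : (0 : R) < n%:R by rewrite ltr0n lt0n.
rewrite -(ler_pM2l a0) mulfV ?gt_eqF// -(ler_pM2l np) mulr1.
by apply: le_trans h3; rewrite le_eqVlt; apply/orP; left; apply/eqP; ring.
Qed.

End ergodicity.

Section conditioning.
Variable x0 : site.

(* Lane-preserving relabelling of the sites that misses exactly x0. *)
Definition skip (x : site) : site :=
  if (x.2 == x0.2) && (x0.1 <= x.1) then (x.1 + 1, x.2) else x.

Definition unskip (x : site) : site :=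
  if (x.2 == x0.2) && (x0.1 < x.1) then (x.1 - 1, x.2) else x.

Lemma skipK : cancel skip unskip.
Proof.
move=> [z i]; rewrite /skip /unskip /=.
have [/andP[/eqP -> h]|h] := boolP ((i == x0.2) && (x0.1 <= z)) => /=.
  by rewrite eqxx (_ : x0.1 < z + 1) /=; [congr pair; lia|lia].
by case: ifP => // /andP[E h']; exfalso; move: h; rewrite E /=; lia.
Qed.

Lemma skip_neq x : skip x != x0.
Proof.
case: x => z i; rewrite /skip /=; case: ifP => [/andP[_ h]|h]; apply/eqP => E.
  by have := congr1 fst E => /=; lia.
by move: h; rewrite -E /= eqxx lexx.
Qed.

Lemma unskipK x : x != x0 -> skip (unskip x) = x.
Proof.
case: x => z i zi; rewrite /skip /unskip /=.
have [/andP[/eqP E h]|h] := boolP ((i == x0.2) && (x0.1 < z)) => /=.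
  by rewrite E eqxx (_ : x0.1 <= z - 1) /=; [congr pair; lia|lia].
case: ifP => // /andP[/eqP E h']; exfalso; move: h zi; rewrite E eqxx /= -leNgt => h.
have -> : z = x0.1 by lia.
by case: (x0) => ? ?; rewrite eqxx.
Qed.

Lemma skip_lane : lane_preserving skip.
Proof. by move=> [z i]; rewrite /skip; case: ifP. Qed.

Lemma unskip_lane : lane_preserving unskip.
Proof. by move=> [z i]; rewrite /unskip; case: ifP. Qed.

Definition insert_site (v : bool) (c : config) : config := fun w => if w == x0 then v else c (unskip w).

Lemma insert_site_skip v c x : insert_site v c (skip x) = c x.
Proof. by rewrite /insert_site (negbTE (skip_neq x)) skipK. Qed.

Lemma sw_insert_site v c x y : sw (skip x) (skip y) (insert_site v c) = insert_site v (sw x y c).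
Proof.
apply/funext => w; have [->|wx] := eqVneq w x0.
  by rewrite /sw swp_n 1?eq_sym ?skip_neq// /insert_site eqxx.
rewrite -(unskipK wx); move: (unskip w) => {wx}w; rewrite insert_site_skip /sw.
have -> : swp (skip x) (skip y) (skip w) = skip (swp x y w).
  by rewrite /swp !(inj_eq (can_inj skipK)); case: ifP => // _; case: ifP.
by rewrite insert_site_skip.
Qed.

(** Pulling back along [skip] makes a full configuration out of the sites other than [x0], so
    conditioning on [x0] yields a law on the same space. *)
Definition slice (v : bool) (B : set config) : set config :=
  pull skip @^-1` B `&` [set eta | eta x0 = v].

Lemma slice_cyl v A c : slice v (cyl A c) = cyl (x0 :: [seq skip x | x <- A]) (insert_site v c).
Proof.
apply/seteqP; split=> eta /=.
  move=> [H ex] w; rewrite inE => /predU1P[->|/mapP[x xA ->]]; first by rewrite /insert_site eqxx.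
  by rewrite insert_site_skip -H.
move=> H; split; last by have /= -> := H x0 (mem_head _ _); rewrite /insert_site eqxx.
move=> x xA; have xs : skip x \in x0 :: [seq skip x | x <- A] by rewrite inE map_f ?orbT.
by have := H _ xs; rewrite insert_site_skip.
Qed.

Lemma measurable_slice v (B : set borel_config) : measurable B -> measurable (slice v B : set borel_config).
Proof. by move=> mB; apply: measurableI; [exact: measurable_preimage_pull|exact: measurable_site]. Qed.

Section conditional.
Context {R : realType}.
Variables (p q : R) (mu : probability borel_config R).
Hypotheses (ex : exchangeable mu) (bal : balanced p q mu).

Let al v : R := fine (mu [set eta : config | eta x0 = v]).

Lemma alE v : mu [set eta : config | eta x0 = v] = (al v)%:E.
Proof. by rewrite /al fineK// fin_num_measure//; exact: measurable_site. Qed.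

(** Since [skip] is a lane-preserving injection, relabelling leaves [mu] unchanged; what remains is
    a split by the value at [x0]. *)
Lemma slice_sum (B : set borel_config) : measurable B -> mu B = (mu (slice true B) + mu (slice false B))%E.
Proof.
move=> mB; rewrite -(ex (can_inj skipK) skip_lane mB).
rewrite -measureU; [|exact: measurable_slice..|].
  congr (mu _); rewrite -setIUr (_ : _ `|` _ = setT) ?setIT//.
  by apply/seteqP; split => // eta _ /=; case: (eta x0); [left|right].
by apply/seteqP; split => // eta [[_ /= h1] [_ /= h2]]; move: h2; rewrite h1.
Qed.

Lemma al_sum : al true + al false = 1.
Proof.
have := slice_sum measurableT; rewrite /slice preimage_setT !setTI !alE.
have -> : mu [set: borel_config] = 1%:E by exact: probability_setT.
by rewrite -EFinD => -[].
Qed.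

(** A relabelling [phi] of the remaining sites lifts to [chi], which fixes [x0], so exchangeability
    is inherited. Balance is inherited from cylinders that also record [x0], where the lifted
    exchange leaves [x0] alone. *)
Lemma conditional_exists v : 0 < al v -> exists m : probability borel_config R,
  (forall B : set borel_config, measurable B -> m B = ((al v)^-1%:E * mu (slice v B))%E) /\
  exchangeable m /\ balanced p q m.
Proof.
move=> av; have ai : 0 <= (al v)^-1 by rewrite invr_ge0 ltW.
have mD := measurable_site x0 v.
have [m1 m1E] := pushforward_measure (mrestr mu mD) (measurable_pull skip).
pose m2 := mscale (NngNum ai) m1.
have [m mE] : exists m : probability borel_config R, forall B : set borel_config, m B = m2 B.
  apply: (@probability_of_measure _ m2); transitivity ((al v)^-1%:E * m1 setT)%E => //.
  rewrite m1E; transitivity ((al v)^-1%:E * (al v)%:E)%E.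
    congr (_ * _)%E; rewrite -alE /mrestr; congr (mu _).
    by apply/seteqP; split => // eta [].
  by rewrite -EFinM mulVf// gt_eqF.
have E (B : set borel_config) : measurable B -> m B = ((al v)^-1%:E * mu (slice v B))%E.
  move=> mB; rewrite mE; transitivity ((al v)^-1%:E * m1 B)%E => //.
  by rewrite m1E.
exists m; split => //; split.
- move=> phi inj lp B mB; rewrite !E//; last exact: measurable_preimage_pull.
  congr (_ * _)%E.
  pose chi w := if w == x0 then x0 else skip (phi (unskip w)).
  have chi_inj : injective chi.
    move=> w w'; rewrite /chi; case: eqP => [->|/eqP wx]; case: eqP => [->|/eqP wx'] //.
    - by move=> h; move: (skip_neq (phi (unskip w'))); rewrite -h eqxx.
    - by move=> h; move: (skip_neq (phi (unskip w))); rewrite h eqxx.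
    - by move=> /(can_inj skipK)/inj h; rewrite -(unskipK wx) -(unskipK wx') h.
  have chi_lane : lane_preserving chi.
    by move=> w; rewrite /chi; case: eqP => [->//|_]; rewrite skip_lane lp unskip_lane.
  rewrite -(ex chi_inj chi_lane (measurable_slice v mB)); congr (mu _).
  have chi_skip : chi \o skip = skip \o phi.
    by apply/funext => w; rewrite /chi /= (negbTE (skip_neq w)) skipK.
  have Epull eta : pull skip (pull chi eta) = pull phi (pull skip eta).
    by apply/funext => w; rewrite /pull -[chi _]/((chi \o skip) w) chi_skip.
  apply/seteqP; split => eta; rewrite /slice /= Epull /pull /chi eqxx => //.
- move=> A c u w u2 w2 uA wA cu cw.
  have prE c1 : pr m A c1 = (al v)^-1 * pr mu (x0 :: [seq skip x | x <- A]) (insert_site v c1).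
    by rewrite {1}/pr E ?slice_cyl ?prE//; exact: measurable_cyl.
  rewrite !prE -sw_insert_site !(mulrCA _ (al v)^-1); congr (_ * _).
  apply: bal; rewrite ?skip_lane ?insert_site_skip//; by rewrite inE map_f ?orbT.
Qed.

End conditional.
End conditioning.

(** * Extremal measures *)

Section parametrization.
Context {R : realType}.
Variables (p q : R).
Hypotheses (p_gt0 : 0 < p) (q_ge0 : 0 <= q).

Let G (x y : R) := p * x * (1 - y) - q * y * (1 - x).

(** On a line of constant total density the increment of [G] factors through [x' - x] with
    nonnegative coefficients. Strictness comes from [p > 0] and from [1 - y' > 0], as
    [y' < y <= 1]. *)
Lemma calF_increasing (x y x' y' : R) : 0 <= x <= 1 -> 0 <= y <= 1 -> 0 <= x' <= 1 -> 0 <= y' <= 1 ->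
  x + y = x' + y' -> x < x' -> G x y < G x' y'.
Proof.
move=> /andP[x0 x1] /andP[y0 y1] /andP[x'0 x'1] /andP[y'0 y'1] E xx'.
have -> : y = y' + (x' - x) by lra.
have d0 : 0 < x' - x by rewrite subr_gt0.
rewrite -subr_gt0.
have -> : G x' y' - G x (y' + (x' - x)) =
  p * ((x' - x) * (x + (1 - y'))) + q * ((x' - x) * (y' + (1 - x))) by rewrite /G; ring.
have h1 : 0 <= q * ((x' - x) * (y' + (1 - x))) by rewrite !mulr_ge0// ?(ltW d0)//; lra.
have h2 : 0 < p * ((x' - x) * (x + (1 - y'))) by rewrite !mulr_gt0//; lra.
lra.
Qed.

Lemma calF_unique (r r' : R * R) : calF p q r -> calF p q r' -> r.1 + r.2 = r'.1 + r'.2 -> r = r'.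
Proof.
case: r r' => x y [x' y'] [/= hx hy E] [/= hx' hy' E'] S.
have [h|h|h] := ltgtP x x'.
- by have := calF_increasing hx hy hx' hy' S h; rewrite /G E E' ltxx.
- by have := calF_increasing hx' hy' hx hy (esym S) h; rewrite /G E E' ltxx.
- by move: S; rewrite h => /addrI ->.
Qed.

Lemma calF_exists (rho : R) : 0 <= rho <= 2 -> exists2 r, calF p q r & r.1 + r.2 = rho.
Proof.
move=> /andP[h0 h2]; pose f t := G t (rho - t).
have cf : continuous f.
  move=> t; rewrite /f /G; apply: cvgB; apply: cvgM.
  - by apply: cvgM; [exact: cvg_cst|exact: cvg_id].
  - by apply: cvgB; [exact: cvg_cst|apply: cvgB; [exact: cvg_cst|exact: cvg_id]].
  - by apply: cvgM; [exact: cvg_cst|apply: cvgB; [exact: cvg_cst|exact: cvg_id]].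
  - by apply: cvgB; [exact: cvg_cst|exact: cvg_id].
(* The ends of the part of the line inside the unit square: one density is 0 or 1 there, which fixes
   the sign of [G]. *)
have [lo [hi [[lh l0 l1] [u0 u1 fl fh]]]] : exists lo hi, [/\ lo <= hi, 0 <= lo & rho - 1 <= lo] /\
    [/\ hi <= 1, hi <= rho, f lo <= 0 & 0 <= f hi].
  have [r1|r1] := leP rho 1.
    exists 0, rho; split; split; rewrite /f /G; try lra.
      rewrite (_ : _ - _ = - (q * rho)); last by ring.
      by rewrite oppr_le0 mulr_ge0.
    rewrite (_ : _ - _ = p * rho); last by ring.
    by rewrite mulr_ge0// ltW.
  exists (rho - 1), 1; split; split; rewrite /f /G; try lra.
    rewrite (_ : _ - _ = - (q * (2 - rho))); last by ring.
    by rewrite oppr_le0 mulr_ge0// subr_ge0.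
  rewrite (_ : _ - _ = p * (2 - rho)); last by ring.
  by rewrite mulr_ge0 ?subr_ge0// ltW.
have [|t] := @IVT R f lo hi 0 lh (continuous_subspaceT cf).
  by apply/andP; split; rewrite ?ge_min ?le_max ?fl ?fh ?orbT.
rewrite in_itv /= => /andP[lt th] ft.
exists (t, rho - t) => /=; last by ring.
by split => //=; apply/andP; split; lra.
Qed.

End parametrization.

Section product_measures.
Context {R : realType}.

Lemma product_bernoulli_eq (r0 r1 : R) (mu nu : probability borel_config R) :
  product_bernoulli r0 r1 mu -> product_bernoulli r0 r1 nu -> measure_eq mu nu.
Proof.
move=> h1 h2 B mB; apply: measure_eq_cyl => //.
  by rewrite -ge0_fin_numE// fin_num_measure.
by move=> A c uA; exact: etrans (h1 A c uA) (esym (h2 A c uA)).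
Qed.

Lemma product_ev_site (r0 r1 : R) (nu : probability borel_config R) x :
  product_bernoulli r0 r1 nu -> ev nu (fun eta => (eta x)%:R) = if x.2 then r1 else r0.
Proof.
move=> h; transitivity (pr nu [:: x] (fun=> true)).
  rewrite -ev_indc; congr ev; apply/funext => eta; rewrite /indc; congr (nat_of_bool _)%:R.
  by apply/esym/asbool_equiv_eqP; [exact: idP|rewrite cyl1].
by rewrite (pr_product h)// big_seq1.
Qed.

End product_measures.

Section extremal_measures.
Context {R : realType}.
Variables (p q d0 l0 d1 l1 : R) (S : R -> (config -> R) -> config -> R).
Hypotheses (p_gt0 : 0 < p) (q_ge0 : 0 <= q).
Hypotheses (d0_ge0 : 0 <= d0) (l0_ge0 : 0 <= l0) (d1_ge0 : 0 <= d1) (l1_ge0 : 0 <= l1).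
Hypotheses (dl0 : 0 < d0 + l0) (dl1 : 0 < d1 + l1).
Hypothesis sepS : sep_semigroup p q d0 l0 d1 l1 S.

Let K := invariant_measures S `&` (@translation_invariant R).

Lemma invariant_translationP (mu : probability borel_config R) :
  K mu <-> exchangeable mu /\ balanced p q mu.
Proof.
split=> [[inv tinv]|[ex bal]].
  apply: (@stationary_exchangeable_balanced _ p q d0 l0 d1 l1) => //.
  exact: (proj1 (sep_invariantP sepS mu)).
split; last exact: exchangeable_translation.
apply: (proj2 (sep_invariantP sepS mu)) => f cf.
exact: exchangeable_balanced_generator.
Qed.

Lemma product_invariant (r : R * R) (nu : probability borel_config R) :
  calF p q r -> product_bernoulli r.1 r.2 nu -> K nu.
Proof.
move=> [_ _ F] h; apply/invariant_translationP; split; first exact: product_exchangeable h.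
by apply: (product_balanced h); apply/eqP; rewrite -subr_eq0 F.
Qed.

(** Each component of a mixture equal to [nu] is translation invariant and dominated by a multiple
    of [nu], so the law of large numbers identifies it with [nu]. *)
Lemma product_extremal (r : R * R) (nu : probability borel_config R) :
  calF p q r -> product_bernoulli r.1 r.2 nu -> extremal K nu.
Proof.
move=> F h; split; first exact: product_invariant h.
move=> m1 m2 a [_ t1] [_ t2] /andP[a0 a1] E.
have a1' : 0 < 1 - a by rewrite subr_gt0.
have pr_mix A c : pr nu A c = a * pr m1 A c + (1 - a) * pr m2 A c.
  by rewrite {1}/pr E ?prE//; exact: measurable_cyl.
have eq m b : translation_invariant m -> 0 < b -> (forall A c, b * pr m A c <= pr nu A c) -> measure_eq m nu.
  move=> t b0 dom B mB; apply: measure_eq_cyl => //.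
    by rewrite -ge0_fin_numE// fin_num_measure.
  move=> A c uA; apply: etrans (prE m A c) _.
  by rewrite (dominated_product_pr h t b0 dom)//; exact: esym (prE nu A c).
split.
- apply: (eq m1 a) => // A c; rewrite (pr_mix A c).
  by rewrite lerDl mulr_ge0// ?pr_ge0// ltW.
- apply: (eq m2 (1 - a)) => // A c; rewrite (pr_mix A c).
  by rewrite lerDr mulr_ge0// ?pr_ge0// ltW.
Qed.

(** [mu] is the mixture of its two conditional laws given the content of [x], both of them in [K].
    Extremality equates them with [mu], which is independence of [x] from the relabelled rest. *)
Lemma extremal_slice (mu : probability borel_config R) x v (B : set borel_config) :
  extremal K mu -> measurable B ->
  mu (slice x v B) = (mu [set eta : config | eta x = v] * mu B)%E.
Proof.
move=> [Kmu ext] mB; have [ex bal] := proj1 (invariant_translationP mu) Kmu.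
pose al w : R := fine (mu [set eta : config | eta x = w]).
have alE w : mu [set eta : config | eta x = w] = (al w)%:E by exact: alE.
have al0 w : 0 <= al w by rewrite fine_ge0.
have sum1 : al true + al false = 1 by exact: (al_sum x ex).
have null w (C : set borel_config) : measurable C -> al w = 0 -> mu (slice x w C) = 0%E.
  move=> mC aw; apply/eqP; rewrite eq_le measure_ge0 andbT.
  have <- : mu [set eta : config | eta x = w] = 0%E by rewrite alE aw.
  by apply: le_measure; rewrite ?inE; [exact: measurable_slice|exact: measurable_site|move=> eta []].
rewrite alE.
(* Extremality speaks of weights strictly between 0 and 1, so a site with deterministic content is
   treated apart. *)
have [av|av] := eqVneq (al v) 0; first by rewrite null// av mul0e.
have avp : 0 < al v by rewrite lt_def av al0.
have [aw|aw] := eqVneq (al (~~ v)) 0.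
  have -> : al v = 1 by move: aw; rewrite -sum1; case: (v) => /= ->; rewrite ?addr0 ?add0r.
  rewrite mul1e (slice_sum x ex mB).
  by case: v aw {av avp} => /= /null ->//; rewrite ?adde0 ?add0e.
have awp : 0 < al (~~ v) by rewrite lt_def aw al0.
have [m1 [m1E m1K]] := conditional_exists ex bal avp.
have [m2 [m2E m2K]] := conditional_exists ex bal awp.
have sumv : al (~~ v) = 1 - al v by rewrite -sum1; case: (v) => /=; ring.
have av1 : 0 < al v < 1 by rewrite avp /=; lra.
have mixE (C : set borel_config) : measurable C ->
    mu C = ((al v)%:E * m1 C + (1 - al v)%:E * m2 C)%E.
  move=> mC; rewrite m1E// m2E// -sumv !muleA -!EFinM !divff ?gt_eqF// !mul1e.
  by rewrite (slice_sum x ex mC); case: (v) => //=; rewrite addeC.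
have [m1mu _] := ext m1 m2 (al v) (proj2 (invariant_translationP m1) m1K)
  (proj2 (invariant_translationP m2) m2K) av1 mixE.
have E1 : m1 B = mu B by exact: m1mu.
by rewrite -E1 m1E// muleA -EFinM divff ?gt_eqF// mul1e.
Qed.

Lemma extremal_product (mu : probability borel_config R) : extremal K mu ->
  exists2 r : R * R, calF p q r & product_bernoulli r.1 r.2 mu.
Proof.
move=> ext; have [ex bal] := proj1 (invariant_translationP mu) ext.1.
pose rho i : R := fine (mu [set eta : config | eta (0, i) = true]).
have rho01 i : 0 <= rho i <= 1.
  rewrite fine_ge0//= -(al_sum (0, i) ex) lerDl; exact: fine_ge0.
have siteE x v : mu [set eta : config | eta x = v] = (bernoulli_pmf (rho x.2) v)%:E.
  have lane w : mu [set eta : config | eta x = w] = mu [set eta : config | eta (0, x.2) = w].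
    rewrite -(ex (swp x (0, x.2)) (@swp_inj _ _) _ _ (measurable_site x w)); last exact: swp_lane.
    by congr (mu _); apply/seteqP; split=> eta /=; rewrite /pull swp_l.
  rewrite lane /bernoulli_pmf; case: v; first exact: alE.
  rewrite alE; congr (_%:E); have := al_sum (0, x.2) ex; rewrite -/(rho x.2) => <-; ring.
have prod A c : uniq A -> mu (cyl A c) = (\prod_(x <- A) bernoulli_pmf (rho x.2) (c x))%:E.
  elim: A => [|x A IH] /=.
    by move=> _; rewrite cyl_nil big_nil; exact: probability_setT.
  move=> /andP[xA uA]; rewrite big_cons EFinM -IH// -siteE.
  (* [A] avoids [x], so its cylinder is the pull-back along [skip x] of a cylinder with the same
     mass; intersecting with the event at [x] gives a slice, where [extremal_slice] factors. *)
  have bij : {in A, cancel (unskip x) (skip x)}.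
    by move=> w wA; apply: unskipK; apply: contraNneq xA => <-.
  have E := pull_cyl_bij c bij.
  rewrite -[in RHS]E ex; [|exact: can_inj (skipK x)|exact: skip_lane|exact: measurable_cyl].
  rewrite -extremal_slice//; last exact: measurable_cyl.
  by rewrite cyl_cons cyl1 /slice E setIC.
exists (rho false, rho true); last first.
  move=> A c uA; rewrite prod//; congr (_%:E); apply: eq_bigr => x _.
  by case: (x.2).
split => //=.
have uv : uniq [:: (0, false) : site; (0, true)] by [].
(* The pattern with lane 0 occupied and lane 1 empty in one column; balance for it is the equation
   defining [calF]. *)
have := bal [:: (0, false); (0, true)] (fun z => ~~ z.2) (0, false) (0, true) erefl erefl.
rewrite !inE !eqxx !orbT => /(_ isT isT erefl erefl).
rewrite /pr !prod// !big_cons !big_nil /sw swp_l swp_r /= /bernoulli_pmf !mulr1 !mulrA => ->.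
by ring.
Qed.

End extremal_measures.

Unset Implicit Arguments.

Theorem theorem2p1 (R : realType) (p q d0 l0 d1 l1 : R)
    (S : R -> (config -> R) -> config -> R)
    (p_ge0 : 0 <= p) (q_ge0 : 0 <= q)
    (d0_ge0 : 0 <= d0) (l0_ge0 : 0 <= l0)
    (d1_ge0 : 0 <= d1) (l1_ge0 : 0 <= l1)
    (dl_gt0 : 0 < (d0 + l0) * (d1 + l1))
    (drift0 : 0 <= d0 - l0)
    (drift01 : 0 <= (d0 - l0) + (d1 - l1))
    (le_qp : q <= p) (p_gt0 : 0 < p)
    (sepS : sep_semigroup p q d0 l0 d1 l1 S) :
  exists nu : R -> probability borel_config R,
    [/\ extremal (invariant_measures S `&` translation_invariant) =
          [set mu : probability borel_config R | exists2 r : R * R, calF p q r &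
                    product_bernoulli r.1 r.2 mu],
        [set mu : probability borel_config R | exists2 r : R * R, calF p q r &
                  product_bernoulli r.1 r.2 mu] =
          [set mu : probability borel_config R | exists2 rho : R, 0 <= rho <= 2 & measure_eq mu (nu rho)] &
        forall rho : R, 0 <= rho <= 2 ->
          ('E_(nu rho)[fun eta : config =>
             ((eta (0, false))%:R + (eta (0, true))%:R)%R] = rho%:E)%E].
Proof.
have [dl0 dl1] : 0 < d0 + l0 /\ 0 < d1 + l1.
  have h0 : 0 <= d0 + l0 by rewrite addr_ge0.
  have h1 : 0 <= d1 + l1 by rewrite addr_ge0.
  by split; rewrite lt_def ?h0 ?h1 andbT; apply: contraTneq dl_gt0 => ->; rewrite ?mul0r ?mulr0 ltxx.
have /choice[nu nuP] : forall rho : R, exists nu : probability borel_config R, 0 <= rho <= 2 ->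
    exists r : R * R, [/\ calF p q r, r.1 + r.2 = rho & product_bernoulli r.1 r.2 nu].
  move=> rho; have [hrho|hrho] := boolP (0 <= rho <= 2); last first.
    (* Outside [[0, 2]] the family is unconstrained, and a Dirac mass serves as placeholder. *)
    by exists (dirac ((fun=> false) : borel_config) : probability _ R).
  have [r Fr sr] := calF_exists p_gt0 q_ge0 hrho.
  have [r1 r2 _] := Fr; have [nu hnu] := product_bernoulli_exists r1 r2.
  by exists nu => _; exists r.
exists nu; split.
- apply/seteqP; split => mu /=.
    exact: (extremal_product p_gt0 q_ge0 d0_ge0 l0_ge0 d1_ge0 l1_ge0 dl0 dl1 sepS).
  by move=> [r Fr]; exact: (product_extremal p_gt0 q_ge0 d0_ge0 l0_ge0 d1_ge0 l1_ge0 dl0 dl1 sepS).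
- apply/seteqP; split => mu /=.
    move=> [r Fr hmu]; have [/andP[x0 x1] /andP[y0 y1] _] := Fr.
    have hr : 0 <= r.1 + r.2 <= 2 by apply/andP; split; lra.
    exists (r.1 + r.2) => //; have [r' [Fr' sr' hnu]] := nuP _ hr.
    apply: (product_bernoulli_eq hmu).
    (* The total density determines the point of [calF], so the measure chosen for [r.1 + r.2] has
       the densities of [mu]. *)
    by rewrite (calF_unique p_gt0 q_ge0 Fr' Fr sr') in hnu.
  move=> [rho hrho E]; have [r [Fr _ hnu]] := nuP _ hrho.
  by exists r => // A c uA; exact: etrans (E _ (measurable_cyl A c)) (hnu A c uA).
- move=> rho hrho; have [r [_ <- hnu]] := nuP _ hrho.
  rewrite expectation_ev; last by apply: continuous_add; exact: continuous_site.
  by rewrite ev_add; [rewrite !(product_ev_site _ hnu)|exact: continuous_site..].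
Qed.
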